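(* Let $k\geq 2$, $\ell_1\geq 3$, $\ell_2\geq 2$ and $r\geq \ell_1+\ell_2+k-1$ be integers, and let $\ell_{\max}=\max\{\ell_1,\ell_2\}$, $\ell_{\min}=\min\{\ell_1,\ell_2\}$. Then there is a constant $C$ depending only on $\ell_1,\ell_2,k,r$ such that for all sufficiently large $n$, $$ (\ell_{\min}-1)\left\lfloor\frac{n-k+1}{r-k+2}\right\rfloor\leq {\rm ex}_r(n,{\rm Berge}\text{-}P_{\ell_1}\cup (k-1)S_{\ell_2})\leq \frac{(\ell_{\max}-1)n}{r-k+2}+C. $$
   Context: An $r$-graph is a hypergraph whose hyperedges are distinct $r$-element subsets of the vertex set. For a graph $F$, an $r$-graph $H$ is a Berge-$F$ if there is a bijection $\phi:E(F)\to E(H)$ with $e\subseteq\phi(e)$ for each $e\in E(F)$; an $r$-graph contains a Berge-$F$ if some subhypergraph is a Berge-$F$. ${\rm ex}_r(n,{\rm Berge}\text{-}F)$ is the maximum number of hyperedges in an $n$-vertex $r$-graph containing no Berge-$F$. $P_m$ is the path with $m$ edges, $S_m$ the star with $m$ edges; $\cup$ is vertex-disjoint union and $cG$ is the disjoint union of $c$ copies of $G$. *)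

(* Defs.v *)
From mathcomp Require Import all_boot all_order all_algebra.

Set Implicit Arguments.
Unset Strict Implicit.
Unset Printing Implicit Defensive.

Record sgraph := SGraph {
  vertex :> finType;
  adj : rel vertex;
  adj_sym : symmetric adj;
  adj_irr : irreflexive adj
}.

Definition edges (G : sgraph) : {set {set G}} :=
  [set [set p.1; p.2] | p : G * G & adj p.1 p.2].

(* P_m: m counts edges, so there are m + 1 vertices. *)
Section Path.
Variable m : nat.

Definition path_adj : rel 'I_m.+1 :=
  fun i j => (i.+1 == j :> nat) || (j.+1 == i :> nat).

Lemma path_adj_sym : symmetric path_adj.
Proof. by move=> i j; rewrite /path_adj orbC. Qed.

Lemma path_adj_irr : irreflexive path_adj.
Proof. by move=> i; rewrite /path_adj orbb gtn_eqF. Qed.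

Definition path_graph : sgraph := SGraph path_adj_sym path_adj_irr.
End Path.

(* S_m: m edges, centre ord0, leaves the m other vertices. *)
Section Star.
Variable m : nat.

Definition star_adj : rel 'I_m.+1 :=
  fun i j => (i == ord0) != (j == ord0).

Lemma star_adj_sym : symmetric star_adj.
Proof. by move=> i j; rewrite /star_adj eq_sym. Qed.

Lemma star_adj_irr : irreflexive star_adj.
Proof. by move=> i; rewrite /star_adj eqxx. Qed.

Definition star_graph : sgraph := SGraph star_adj_sym star_adj_irr.
End Star.

Section DisjointUnion.
Variables G H : sgraph.

Definition dunion_adj : rel (G + H)%type := fun x y =>
  match x, y with
  | inl a, inl b => adj a b
  | inr a, inr b => adj a b
  | _, _ => false
  end.

Lemma dunion_adj_sym : symmetric dunion_adj.
Proof. by move=> [a|a] [b|b] //=; rewrite adj_sym. Qed.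

Lemma dunion_adj_irr : irreflexive dunion_adj.
Proof. by move=> [a|a] /=; rewrite adj_irr. Qed.

Definition dunion : sgraph := SGraph dunion_adj_sym dunion_adj_irr.
End DisjointUnion.

Section Copies.
Variables (c : nat) (G : sgraph).

Definition copies_adj : rel ('I_c * G)%type :=
  fun x y => (x.1 == y.1) && adj x.2 y.2.

Lemma copies_adj_sym : symmetric copies_adj.
Proof. by move=> x y; rewrite /copies_adj eq_sym adj_sym. Qed.

Lemma copies_adj_irr : irreflexive copies_adj.
Proof. by move=> x; rewrite /copies_adj adj_irr andbF. Qed.

Definition copies : sgraph := SGraph copies_adj_sym copies_adj_irr.
End Copies.

Section Berge.
Variable V : finType.

(* A hypergraph on V is its set of hyperedges. *)
Definition uniform (r : nat) (H : {set {set V}}) : bool :=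
  [forall e in H, #|e| == r].

(* The injection f places the vertices of F in V, so that "e is contained in
   phi(e)" makes sense; phi restricts to a bijection from E(F) onto H. *)
Definition is_berge (F : sgraph) (H : {set {set V}}) : bool :=
  [exists f : {ffun F -> V}, exists phi : {ffun {set F} -> {set V}},
    [&& injectiveb f, dinjectiveb phi (mem (edges F)), phi @: edges F == H
      & [forall e in edges F, f @: e \subset phi e]]].

Definition contains_berge (F : sgraph) (H : {set {set V}}) : bool :=
  [exists H' : {set {set V}}, (H' \subset H) && is_berge F H'].
End Berge.

Definition ex_berge (r n : nat) (F : sgraph) : nat :=
  \max_(H : {set {set 'I_n}} | uniform r H && ~~ contains_berge F H) #|H|.

(* Main.v *)
Require Import Defs.
From mathcomp Require Import all_boot all_order all_algebra.
From mathcomp Require Import zify.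

Set Implicit Arguments.
Unset Strict Implicit.
Unset Printing Implicit Defensive.

Import Order.TTheory GRing.Theory Num.Theory.

(** Put [s = r - k + 2].

    Lower bound: fix a core of [k - 1] vertices and cut the rest into blocks of
    size [s]; the hyperedges are the core plus a block minus one of the first
    [min l1 l2 - 1] vertices of that block.  One of the [k] components of a
    Berge copy avoids the core, hence lives in a single block, which has too few
    hyperedges.

    Upper bound: the key estimate is a Gyori-Katona-Lemons type bound
    [s |F| <= (l - 1) |V|] for hyperedges of size at least [s - 1] (any two of
    which cover [s] vertices) without a Berge path of length [l].  In a minimal
    counterexample every vertex set [S] meets more than [(l - 1) |S| / s]
    hyperedges; this forces rotations of a longest Berge path to close up into a
    cycle, which contradicts maximality.  Let [K] be the set of vertices of
    large degree.  If [|K| <= k - 2], hyperedges keep at least [s] vertices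
    outside [K] and degrees there are bounded, so that a path and then [k - 1]
    stars can be found far from each other.  If [|K| >= k - 1], remove [k - 1]
    vertices of [K], find a path, and use the removed vertices as centres of the
    stars; distinct hyperedges still cover [s] of the remaining vertices. *)

(** * Edge paths in the incidence graph *)

Section EdgePaths.
Variables (V E : finType) (tau : E -> {set V}) (F : {set E}).

(** Hyperedges are labels in [E] with a trace [tau e], later taken to be [e :\: K]. Hyperedges whose
    traces coincide therefore remain different nodes of the incidence graph. *)
Definition inc : rel (V + E) := fun x y =>
  match x, y with
  | inl v, inr e | inr e, inl v => v \in tau e
  | _, _ => false
  end.

Lemma inc_sym : symmetric inc.
Proof. by case=> [v|e] [w|f]. Qed.

Lemma inc_vertex z v : inc z (inl v) -> exists2 e, z = inr e & v \in tau e.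
Proof. by case: z => // e ve; exists e. Qed.

Definition edges_of (w : seq (V + E)) : {set E} := [set e | inr e \in w].

(* A Berge path without its two end vertices: a path of the incidence graph
   from the hyperedge [a] to the hyperedge [b], using hyperedges of [F]. *)
Definition epath (a b : E) (p : seq (V + E)) : Prop :=
  [/\ path inc (inr a) p, last (inr a) p = inr b, uniq (inr a :: p)
    & edges_of (inr a :: p) \subset F].

Definition touching (S : {set V}) : {set E} := [set e in F | tau e :&: S != set0].

Lemma mem_touching e v (S : {set V}) :
  e \in F -> v \in tau e -> v \in S -> e \in touching S.
Proof.
by move=> eF ve vS; rewrite inE eF; apply/set0Pn; exists v; rewrite inE ve.
Qed.

Lemma epath_rev a b p : epath a b p ->
  exists2 q, epath b a q & inr b :: q = rev (inr a :: p).
Proof.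
case=> pp lp up Fp; exists (rev (belast (inr a) p)); last first.
  by rewrite [in RHS]lastI rev_rcons lp.
have E1 : inr b :: rev (belast (inr a) p) = rev (inr a :: p).
  by rewrite [in RHS]lastI rev_rcons lp.
split.
- rewrite -lp rev_path; rewrite (@eq_path _ _ inc) // => x y.
  by rewrite inc_sym.
- by case: (p) lp => [[->]|x q _] //=; rewrite rev_cons last_rcons.
- by move: up; rewrite -rev_uniq -E1.
- apply: subset_trans Fp; apply/subsetP => e.
  by rewrite ![_ \in edges_of _]inE E1 mem_rev.
Qed.

Lemma edges_of_eq w w' : w =i w' -> edges_of w = edges_of w'.
Proof. by move=> ww; apply/setP => e; rewrite !inE ww. Qed.

Lemma epath_extend a b p v e : epath a b p -> v \in tau b -> inl v \notin p ->
  e \in F -> v \in tau e -> inr e \notin inr a :: p ->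
  let q := p ++ [:: inl v; inr e] in
  epath a e q /\ edges_of (inr a :: q) = e |: edges_of (inr a :: p).
Proof.
move=> [pp lp up Fp] vb vp eF ve ep.
have Eq : edges_of (inr a :: p ++ [:: inl v; inr e]) =
  e |: edges_of (inr a :: p).
  apply/setP=> f; rewrite !inE mem_cat !inE -[inr f == inr e]/(f == e).
  by rewrite -[inr f == inl v]/false; case: (f == e); rewrite ?orbT ?orbF.
split => //; split.
- by rewrite cat_path pp lp /= vb ve.
- by rewrite last_cat.
- rewrite -cat_cons cat_uniq up /= !inE orbF negb_or andbT.
  by move: ep; rewrite inE negb_or => /andP[-> ->]; rewrite vp.
- rewrite Eq; apply/subsetP => f; rewrite in_setU1 => /orP[/eqP->//|].
  exact: (subsetP Fp).
Qed.

Lemma epath_of_cycle u q : q != [::] -> ucycle inc (inl u :: q) ->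
  edges_of (inl u :: q) \subset F ->
  exists a b p, [/\ q = inr a :: p, epath a b p, u \in tau a & u \in tau b].
Proof.
case: q => // [[v|a] p] _ /andP[]; rewrite /= //.
move=> /andP[ua]; rewrite rcons_path => /andP[pp lu] /andP[uap up] FX.
have [b lp ub] := inc_vertex lu.
by exists a, b, p; split.
Qed.

Lemma cycle_of_epath u a b p : epath a b p -> u \in tau a -> u \in tau b ->
  inl u \notin p -> ucycle inc (inl u :: inr a :: p).
Proof.
move=> [pp lp up Fp] ua ub uip; apply/andP; split.
  by rewrite /= ua rcons_path pp lp.
by rewrite cons_uniq up inE andbT negb_or uip.
Qed.

Lemma next_split (T : eqType) (w1 w2 : seq T) x y :
  uniq (w1 ++ x :: y :: w2) -> next (w1 ++ x :: y :: w2) x = y.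
Proof.
move=> uw; rewrite -(next_rot (size w1)) // rot_size_cat /=.
by rewrite eqxx.
Qed.

Lemma prev_split (T : eqType) (w1 w2 : seq T) x y :
  uniq (w1 ++ x :: y :: w2) -> prev (w1 ++ x :: y :: w2) y = x.
Proof. by move=> uw; rewrite -{2}(next_split uw) prev_next. Qed.


(** The incidence graph is bipartite and both ends of the path are hyperedges, so an inner vertex
    has a hyperedge on either side. *)
Lemma vertex_split a b p v : path inc (inr a) p -> last (inr a) p = inr b ->
  inl v \in p -> exists w1 g f w2, inr a :: p = w1 ++ inr g :: inl v :: inr f :: w2.
Proof.
move=> pp lp /(nthP (inr a))[i ip nth_i].
have := pp; have := lp; rewrite -(cat_take_drop i p) (drop_nth (inr a) ip) nth_i.
rewrite cat_path last_cat => /= lp2 /and3P[pp1 lv pp2].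
case: (drop i.+1 p) lp2 pp2 => [|[u|f] q] //= lp2 /andP[vf pp2].
have [g L gv] := inc_vertex lv.
exists (belast (inr a) (take i p)), g, f, q.
by rewrite -cat_cons lastI L cat_rcons.
Qed.

Lemma edge_split a b p f : path inc (inr a) p -> last (inr a) p = inr b ->
  f != b -> inr f \in inr a :: p ->
  exists w1 x h w2, x \in tau h /\
    inr a :: p = w1 ++ inr f :: inl x :: inr h :: w2.
Proof.
rewrite inE => pp lp fb /orP[/eqP[fa]|].
  case: p pp lp => [_ [ab]|[x|h] p] //=; first by rewrite fa ab eqxx in fb.
  case: p => [_ //|[y|h] p] /=; first by rewrite andbF.
  by move=> /and3P[_ xh _] _; exists [::], x, h, p; rewrite fa.
move=> /(nthP (inr a))[i ip nth_i].
have := pp; have := lp; rewrite -(cat_take_drop i p) (drop_nth (inr a) ip) nth_i.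
rewrite cat_path last_cat => /= lp2 /and3P[pp1 lv pp2].
case: (drop i.+1 p) lp2 pp2 => [|[u|h] q] //=.
  by case=> fb' _; rewrite fb' eqxx in fb.
case: q => [//|[y|h] q] /=; first by rewrite andbF.
move=> _ /and3P[_ uh _].
by exists (inr a :: take i p), u, h, q.
Qed.

(** This is a Pósa rotation: [y] is dropped, and the new element [t] joins [x] to the old last
    element, so that the tail from [z] is run backwards and [z] becomes the last element. *)
Lemma sorted_rotate (T : eqType) (e : rel T) w1 x y z t w2 : symmetric e ->
  sorted e (w1 ++ x :: y :: z :: w2) -> e x t -> e t (last z w2) ->
  sorted e (w1 ++ x :: t :: rev (z :: w2)).
Proof.
move=> esym so xt tl.
have rp : path e z w2 -> path e t (rev (z :: w2)).
  move=> pz; rewrite lastI rev_rcons /= tl rev_path (@eq_path _ _ e) //.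
case: w1 so => [|u w1] /=; last rewrite !cat_path /=.
  by rewrite xt => /and3P[_ _ /rp].
by rewrite xt => /and5P[-> -> _ _ /rp].
Qed.

Lemma uniq_rotate (T : eqType) (w1 : seq T) x y z t w2 :
  uniq (w1 ++ x :: y :: z :: w2) -> t \notin w1 ++ x :: y :: z :: w2 ->
  uniq (w1 ++ x :: t :: rev (z :: w2)).
Proof.
move=> uw tw.
have pe : perm_eq (w1 ++ x :: t :: rev (z :: w2)) (t :: w1 ++ x :: z :: w2).
  by apply/permP=> P; rewrite /= !count_cat /= count_rev /=; lia.
have sub : subseq (w1 ++ x :: z :: w2) (w1 ++ x :: y :: z :: w2).
  apply: cat_subseq => //; rewrite -(cat1s x (z :: w2)) -(cat1s x (y :: _)).
  by apply: cat_subseq => //; apply: subseq_cons.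
rewrite (perm_uniq pe) cons_uniq (subseq_uniq sub uw) andbT.
by apply: contra tw => /(mem_subseq sub).
Qed.

(** These two projections turn values of [next] and [prev] into hyperedges or vertices; the first
    argument is a default for the wrong side of the sum. *)
Definition edge_at (g : E) (z : V + E) : E := if z is inr f then f else g.
Definition vertex_at (u : V) (z : V + E) : V := if z is inl v then v else u.

(** Sending an inner vertex to the hyperedge that follows it is injective and misses the first
    hyperedge [a]. *)
Lemma card_vertices a b p : epath a b p ->
  #|[set v | inl v \in p]| < #|edges_of (inr a :: p)|.
Proof.
move=> [pp lp up Fp]; pose g v := edge_at a (next (inr a :: p) (inl v)).
have gE v : inl v \in p -> next (inr a :: p) (inl v) = inr (g v) /\
    g v \in edges_of (inr a :: p) :\ a.
  move=> vp; have [w1 [h [f [w2 Ew]]]] := vertex_split pp lp vp.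
  have nv : next (inr a :: p) (inl v) = inr f.
    by rewrite Ew -cat_rcons next_split // cat_rcons -Ew.
  rewrite /g nv; split=> //=; rewrite !inE.
  have: inr f \in behead (inr a :: p).
    by rewrite Ew; case: (w1) => [|z w]; rewrite /= ?mem_cat !inE eqxx ?orbT.
  rewrite /= => fp; rewrite fp orbT andbT; apply: contraTneq fp => ->.
  by case/andP: up.
have ginj : {in [set v | inl v \in p] &, injective g}.
  move=> u v; rewrite !inE => up' vp guv.
  have [[nu _] [nv _]] := (gE _ up', gE _ vp).
  have : next (inr a :: p) (inl u) = next (inr a :: p) (inl v).
    by rewrite nu nv guv.
  by move/(can_inj (prev_next up)) => -[].
rewrite -(card_in_imset ginj) [X in _ < X](cardsD1 a) !inE eqxx add1n ltnS.
apply/subset_leq_card/subsetP => e /imsetP[v]; rewrite inE => vp ->.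
exact: (gE _ vp).2.
Qed.

End EdgePaths.

Lemma cat_uniq_inj (T : eqType) (s1 s2 t1 t2 : seq T) x :
  uniq (s1 ++ x :: t1) -> s1 ++ x :: t1 = s2 ++ x :: t2 -> s1 = s2 /\ t1 = t2.
Proof.
move=> us E12.
have idx (s t : seq T) : uniq (s ++ x :: t) -> index x (s ++ x :: t) = size s.
  rewrite cat_uniq /= negb_or => /and3P[_ /andP[xs _] _].
  by rewrite index_cat (negPf xs) /= eqxx addn0.
have sz : size s1 = size s2.
  by rewrite -(idx s1 t1) // E12 idx // -E12.
by move/eqP: E12; rewrite eqseq_cat // eqseq_cons eqxx /= => /andP[/eqP-> /eqP->].
Qed.

(** * Longest edge paths *)

Section Longest.
Variables (V E : finType) (tau : E -> {set V}) (F : {set E}) (l s m : nat).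
Hypotheses (l3 : 3 <= l) (sl : l + 3 <= s) (m1 : 0 < m) (ml : m < l).
Hypothesis size_tau : forall e, e \in F -> s <= #|tau e|.+1.
Hypothesis size_tau2 : forall e f, e \in F -> f \in F -> e != f ->
  s <= #|tau e :|: tau f|.
Hypothesis expand : forall S : {set V}, S != set0 ->
  S \subset \bigcup_(e in F) tau e -> l.-1 * #|S| < s * #|touching tau F S|.
Hypothesis longest : forall a b p, epath tau F a b p ->
  #|edges_of (inr a :: p)| <> m.+1.

(** These are the vertices through which some edge path with hyperedge set [X] could be prolonged by
    a new hyperedge. *)
Let is_end (X : {set E}) (v : V) := exists a b p,
  [/\ epath tau F a b p, edges_of (inr a :: p) = X, v \in tau b & inl v \notin p].

(** A hyperedge outside [X] through an end would give a path with [m.+1] hyperedges, so only the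
    [m <= l.-1] members of [X] can touch [S]. Then [expand] gives [l.-1 * #|S| < s * l.-1]. *)
Lemma ends_lt (X : {set E}) (S : {set V}) : #|X| = m ->
  (forall v, v \in S -> is_end X v) -> #|S| < s.
Proof.
move=> Xm Send.
have [->|S0] := eqVneq S set0; first by rewrite cards0; lia.
have SF : S \subset \bigcup_(e in F) tau e.
  apply/subsetP => v /Send[a [b [p [[pp lp up Fp] _ vb _]]]].
  apply/bigcupP; exists b => //; apply: (subsetP Fp).
  by rewrite inE -lp mem_last.
have := expand S0 SF.
have : #|touching tau F S| <= m.
  rewrite -Xm; apply/subset_leq_card/subsetP => e.
  rewrite inE => /andP[eF /set0Pn[v]]; rewrite inE => /andP[ve /Send].
  move=> [a [b [p [ep Xp vb vp]]]]; apply: contraT => eX.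
  have ep' : inr e \notin inr a :: p by move: eX; rewrite -Xp inE.
  have [eq_ Eq] := epath_extend ep vb vp eF ve ep'.
  by case: (longest eq_); rewrite Eq cardsU1 Xp eX Xm.
nia.
Qed.

(** Cutting the cycle at a suitable place makes every vertex of every one of its hyperedges an end.
    Two distinct hyperedges already cover [s] vertices, against [ends_lt]. *)
Lemma no_full_cycle (c : seq (V + E)) : 2 <= m -> ucycle (inc tau) c ->
  edges_of c \subset F -> #|edges_of c| <> m.
Proof.
move=> m2 uc Fc Xm.
set X := edges_of c in Fc Xm.
set S := \bigcup_(e in X) tau e.
have [e [f [eX fX ef]]] : exists e f, [/\ e \in X, f \in X & e != f].
  have /set0Pn[e eX] : X != set0 by rewrite -card_gt0; lia.
  have /set0Pn[f] : X :\ e != set0.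
    by rewrite -card_gt0; have := cardsD1 e X; rewrite eX; lia.
  by rewrite in_setD1 => /andP[fe fX]; exists e, f; rewrite eq_sym.
have : s <= #|S|.
  apply: leq_trans (size_tau2 (subsetP Fc _ eX) (subsetP Fc _ fX) ef) _.
  apply/subset_leq_card; rewrite subUset.
  by rewrite (bigcup_sup e) // (bigcup_sup f).
suff : #|S| < s by lia.
apply: (ends_lt Xm) => v /bigcupP[g gX vg].
have rotX i : edges_of (rot i c) = X.
  by apply: edges_of_eq => z; rewrite mem_rot.
case: (boolP (inl v \in c)) => vc.
  have [i q cq] := rot_to vc.
  have q0 : q != [::].
    apply/eqP => q0; have := rotX i; rewrite cq q0 => /setP/(_ e).
    by rewrite eX !inE.
  have uq : ucycle (inc tau) (inl v :: q) by rewrite -cq rot_ucycle.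
  have Fq : edges_of (inl v :: q) \subset F by rewrite -cq rotX.
  have [a [b [p [Eq ep va vb]]]] := epath_of_cycle q0 uq Fq.
  exists a, b, p; split => //.
    by rewrite -Eq -(rotX i) cq; apply/setP => h; rewrite !inE.
  by move: uq; rewrite Eq /ucycle /= => /andP[_]; rewrite inE negb_or => /andP[/andP[]].
(* For [v] off the cycle, the cut is made at the cycle vertex [u] that follows [g]: dropping [u]
   leaves a path that ends in [g], and [v] lies in [tau g]. *)
have gc : inr g \in c by rewrite inE in gX.
have [i q cq] := rot_to gc.
have uq : ucycle (inc tau) (rcons q (inr g)).
  by rewrite -rot1_cons -cq !rot_ucycle.
have Xq : edges_of (rcons q (inr g)) = X.
  by rewrite -(rotX i) cq; apply: edges_of_eq => z; rewrite mem_rcons.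
have vq : inl v \notin rcons q (inr g).
  by rewrite mem_rcons -cq mem_rot.
case: q cq uq Xq vq => [|[u|h] q] cq uq Xq vq.
- by move/setP: Xq => Xq; have := Xq e; have := Xq f; rewrite eX fX !inE => /eqP[fg] /eqP[eg]; rewrite fg eg eqxx in ef.
- rewrite rcons_cons in uq Xq vq.
  have q0 : rcons q (inr g) != [::] by case: (q).
  have Fq : edges_of (inl u :: rcons q (inr g)) \subset F by rewrite Xq.
  have [a [b [p [Eq ep va vb]]]] := epath_of_cycle q0 uq Fq.
  exists a, b, p; split => //.
  + by rewrite -Eq -Xq; apply/setP => h; rewrite !inE.
  + have [_ lp _ _] := ep.
    have : last (inr a) (inr a :: p) = inr g by rewrite -Eq last_rcons.
    by rewrite /= lp => -[->].
  + by move: vq; rewrite Eq !inE !negb_or => /and3P[].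
- by have := uc; rewrite -(rot_ucycle i) cq /ucycle /=.
Qed.

(** The main point is the first bound. The ends include all of [U], one end per hyperedge of
    [touching tau F U] other than [b] (by rotation), and one vertex of the first hyperedge. These
    are distinct, so [#|U| + #|touching tau F U| < s] by [ends_lt], while [tau b] has at least
    [s.-1] vertices. *)
Lemma last_edge_bounds a b p : 2 <= m -> epath tau F a b p ->
  #|edges_of (inr a :: p)| = m ->
  let U := [set v in tau b | inl v \notin p] in
  let P := [set v in tau b | inl v \in p] in
  [/\ #|touching tau F U| <= #|P|, s <= (#|U| + #|P|).+1,
      l.-1 * #|U| < s * #|touching tau F U| &
      touching tau F U \subset edges_of (inr a :: p)].
Proof.
move=> m2 ep Xm U P; have [pp lp up Fp] := ep.
set X := edges_of _ in Fp Xm.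
set w := inr a :: p.
have bX : b \in X by rewrite inE -lp mem_last.
have aX : a \in X by rewrite inE mem_head.
have UP e : #|[set v in tau e | inl v \notin p]| +
    #|[set v in tau e | inl v \in p]| = #|tau e|.
  rewrite -(cardsID [set v | inl v \notin p] (tau e)); congr (_ + _).
    by apply: eq_card => v; rewrite !inE.
  by apply: eq_card => v; rewrite !inE negbK andbC.
have sUP : s <= (#|U| + #|P|).+1.
  by rewrite UP; apply: size_tau; apply: (subsetP Fp).
have vm := card_vertices ep; rewrite Xm in vm.
have off e : e \in F -> exists2 v, v \in tau e & inl v \notin p.
  move=> eF; have : 0 < #|[set v in tau e | inl v \notin p]|.
    have := UP e; have := size_tau eF.
    suff : #|[set v in tau e | inl v \in p]| <= #|[set v | inl v \in p]| by lia.
    by apply/subset_leq_card/subsetP => v; rewrite !inE => /andP[].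
  by rewrite card_gt0 => /set0Pn[v]; rewrite inE => /andP[]; exists v.
have U0 : U != set0.
  by have [v vb vp] := off b (subsetP Fp _ bX); apply/set0Pn; exists v; rewrite inE vb.
have UF : U \subset \bigcup_(e in F) tau e.
  apply/subsetP => v; rewrite inE => /andP[vb _]; apply/bigcupP.
  by exists b => //; apply: (subsetP Fp).
have exU := expand U0 UF.
set A := touching tau F U in exU *.
have Uend v : v \in U -> is_end X v.
  by rewrite inE => /andP[vb vp]; exists a, b, p.
have AX : A \subset X.
  apply/subsetP => e; rewrite inE => /andP[eF /set0Pn[v]]; rewrite inE => /andP[ve].
  rewrite inE => /andP[vb vp]; apply: contraT => eX.
  have ep' : inr e \notin inr a :: p by move: eX; rewrite inE.
  have [eq_ Eq] := epath_extend ep vb vp eF ve ep'.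
  by case: (longest eq_); rewrite Eq cardsU1 -/X eX Xm.
split=> //.
(* The vertex [x0] is an end of the reversed path. It is not in [U], since otherwise it would close
   the path into a cycle with [m] hyperedges. *)
have [x0 x0a x0p] := off a (subsetP Fp _ aX).
have x0U : x0 \notin U.
  apply/negP; rewrite inE => /andP[x0b _].
  apply: (no_full_cycle m2 (cycle_of_epath ep x0a x0b x0p)).
    by apply: subset_trans Fp; apply/subsetP => e; rewrite !inE.
  by rewrite -Xm; apply: eq_card => e; rewrite !inE.
have x0end : is_end X x0.
  have [q eq_ Eq] := epath_rev ep.
  exists b, a, q; split => //.
    by rewrite Eq; apply: edges_of_eq => z; rewrite mem_rev.
  apply: contra x0p => x0q; have : inl x0 \in inr b :: q by rewrite inE x0q.
  by rewrite Eq mem_rev inE.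
(* The vertex after [f] on the path is the one freed by the rotation at [f]. *)
pose g f := vertex_at x0 (next w (inr f)).
have gE f : f \in A :\ b ->
    [/\ next w (inr f) = inl (g f), inl (g f) \in p & is_end X (g f)].
  rewrite in_setD1 => /andP[fb fA].
  have fw : inr f \in w by have := subsetP AX _ fA; rewrite inE.
  have [w1 [x [h [w2 [xh Ew]]]]] := edge_split pp lp fb fw.
  have nf : next w (inr f) = inl x by rewrite /w Ew next_split // -Ew.
  rewrite /g nf /=.
  have xw : inl x \in w by rewrite /w Ew mem_cat !inE eqxx !orbT.
  split=> //.
  move: fA; rewrite inE => /andP[fF /set0Pn[y]]; rewrite inE => /andP[yf].
  rewrite inE => /andP[yb yp].
  (* rotation: the tail after [f] is traversed backwards, entered through [y] *)
  have : exists q, w1 ++ inr f :: inl y :: rev (inr h :: w2) = inr a :: q.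
    by case: (w1) Ew => [|z w1'] [-> _]; eexists.
  move=> [q Eq].
  have mq z : z != inl x -> (z \in inr a :: q) = (z == inl y) || (z \in w).
    move=> zx; rewrite -Eq /w Ew !mem_cat !in_cons mem_rev (negPf zx) /= in_cons.
    by case: (z == inl y); rewrite ?orbT.
  have yx : y != x by apply: contraNneq yp => ->.
  have Xq : edges_of (inr a :: q) = X.
    by apply/setP => e; rewrite [RHS]in_set in_set mq.
  have xq : inl x \notin inr a :: q.
    have := up; rewrite -Eq Ew cat_uniq /= !mem_cat !inE mem_rev !inE.
    move=> /and3P[_ /norP[_ /norP[xw1 _]] /and3P[_ xhw2 _]].
    by rewrite (negPf xw1) /=; case: eqP => [[xy]|_] /=; [rewrite xy eqxx in yx|].
  exists a, h, q; split=> //.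
  have lh : last (inr h) w2 = inr b.
    by have : last (inr a) (inr a :: p) = inr b by []; rewrite Ew last_cat /=.
  split.
  - rewrite -[path _ _ _]/(sorted (inc tau) (inr a :: q)) -Eq.
    apply: (@sorted_rotate _ _ _ _ (inl x)); rewrite ?lh //; first exact: inc_sym.
    by rewrite -Ew.
  - rewrite -[last _ _]/(last (inr a) (inr a :: q)) -Eq last_cat /=.
    by rewrite rev_cons last_rcons.
  - by rewrite -Eq; apply: (@uniq_rotate _ _ _ (inl x)); rewrite -Ew // inE.
  - by rewrite Xq.
have ginj : {in A :\ b &, injective g}.
  move=> f h /gE[nf _ _] /gE[nh _ _] gfh.
  have : next w (inr f) = next w (inr h) by rewrite nf nh gfh.
  by move/(can_inj (prev_next up)) => -[].
have bA : b \in A.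
  have [v vU] := set0Pn _ U0; apply: (mem_touching _ _ vU).
    exact: (subsetP Fp).
  by move: vU; rewrite inE => /andP[].
set I := g @: (A :\ b).
have Ip v : v \in I -> inl v \in p by move=> /imsetP[f /gE[_ gp _] ->].
have cI : #|I|.+1 = #|A| by rewrite card_in_imset // (cardsD1 b A) bA.
have dUI : [disjoint U & I].
  rewrite -setI_eq0; apply/eqP/setP => v; rewrite !inE.
  by apply/negP => /andP[/andP[_ vp] /Ip]; apply/negP.
have : #|x0 |: (U :|: I)| < s.
  apply: (ends_lt Xm) => v; rewrite in_setU1 in_setU => /or3P[/eqP-> //|/Uend//|].
  by move=> /imsetP[f /gE[_ _ ?] ->].
have x0I : x0 \notin U :|: I.
  by rewrite in_setU (negPf x0U) /=; apply: contra x0p => /Ip.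
rewrite cardsU1 x0I cardsU (disjoint_setI0 dUI) cards0 subn0.
by move: cI sUP; lia.
Qed.

(** If [p.*2 <= l.-1], then [s <= (s.-1 - p).*2] because [s >= l + 3], so [l.-1 * u >= p.*2 * (s.-1
    - p) >= s * p >= s * a], a contradiction. *)
Lemma bounds_double a u p : 0 < s -> a <= p -> s <= (u + p).+1 ->
  l.-1 * u < s * a -> l <= p.*2.
Proof.
move=> s0 ap sup lt.
have : l.-1 * (s.-1 - p) < s * p.
  have h1 : s.-1 - p <= u by lia.
  have := leq_mul (leqnn l.-1) h1; have := leq_mul (leqnn s) ap; lia.
move=> h; rewrite leqNgt; apply/negP => pl.
have h2 : p.*2 <= l.-1 by lia.
have h3 : s <= (s.-1 - p).*2 by lia.
have := leq_mul h2 (leqnn (s.-1 - p)); have := leq_mul (leqnn p) h3.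
lia.
Qed.

(** The cycle can be opened at every vertex of [Q], the part of [tau f] on [c], and then prolonged
    to [f]. The hyperedges following [Q] on the cycle avoid those touching the rest of [tau f],
    which gives [#|A| + #|Q| <= m]. Together with [last_edge_bounds] for the last hyperedge [f],
    this is numerically impossible. *)
Lemma no_near_full_cycle (X : {set E}) (c : seq (V + E)) f x : 2 <= m -> #|X| = m ->
  X \subset F -> f \in X -> ucycle (inc tau) c -> edges_of c = X :\ f ->
  x \in tau f -> inl x \in c -> False.
Proof.
move=> m2 Xm XF fX uc Xc.
have s0 : 0 < s by lia.
have fc : inr f \notin c.
  by move/setP/(_ f): Xc; rewrite !inE eqxx /= => ->.
pose Q := [set v in tau f | inl v \in c].
have openc v : v \in Q -> exists a b p, [/\ epath tau F a b p,
    v \in tau a & v \in tau b] /\ exists2 i, rot i c = inl v :: inr a :: p &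
    let q := p ++ [:: inl v; inr f] in
    epath tau F a f q /\ edges_of (inr a :: q) = X.
  rewrite inE => /andP[vf vc]; have [i q cq] := rot_to vc.
  have uq : ucycle (inc tau) (inl v :: q) by rewrite -cq rot_ucycle.
  have q0 : q != [::] by case: (q) uq.
  have Xq : edges_of (inl v :: q) = X :\ f.
    by rewrite -Xc -cq; apply: edges_of_eq => z; rewrite mem_rot.
  have Fq : edges_of (inl v :: q) \subset F.
    by rewrite Xq; apply: subset_trans XF; apply: subsetDl.
  have [a [b [p [Eq ep va vb]]]] := epath_of_cycle q0 uq Fq.
  exists a, b, p; split => //; exists i; first by rewrite cq Eq.
  have vp : inl v \notin p.
    by move: uq; rewrite Eq /ucycle /= => /andP[_]; rewrite inE negb_or => /andP[/andP[]].
  have fp : inr f \notin inr a :: p.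
    by apply: contra fc => fp; rewrite -(mem_rot i) cq Eq inE fp orbT.
  have [eq_ Eq2] := epath_extend ep vb vp (subsetP XF _ fX) vf fp; split => //.
  rewrite [LHS]Eq2 -(setD1K fX) -Xq Eq; by congr (_ |: _).
move=> xf xc; have xQ : x \in Q by rewrite inE xf.
have [a [b [p [[ep xa xb] [i cq [eq_ Xq]]]]]] := openc x xQ.
have Xqm : #|edges_of (inr a :: p ++ [:: inl x; inr f])| = m by rewrite Xq.
have [ap sup lt AX] := last_edge_bounds m2 eq_ Xqm.
have mem_q v : (inl v \in p ++ [:: inl x; inr f]) = (inl v \in c).
  by rewrite -[RHS](mem_rot i) cq mem_cat !inE /= orbF orbC.
rewrite (_ : [set v in tau f | inl v \in _] = Q) in ap sup; last first.
  by apply/setP => v; rewrite !inE mem_q.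
set U := [set v in _ | _] in ap sup lt AX; rewrite Xq in AX.
set A := touching tau F U in ap lt AX.
have Q2 := bounds_double s0 ap sup lt.
pose nx v := edge_at f (next c (inl v)).
have uqc : uniq c by case/andP: uc.
have nxE v : v \in Q -> [/\ next c (inl v) = inr (nx v), nx v \in X & nx v \notin A].
  move=> vQ; have [a' [b' [p' [[ep' va vb] [j cj [ej Xj]]]]]] := openc v vQ.
  have nv : next c (inl v) = inr a'.
    by rewrite -(next_rot j) // cj /= eqxx.
  rewrite /nx nv /=; split=> //; first by rewrite -Xj inE mem_head.
  (* The path opened at [v] runs from [nx v] to [f]. A vertex [y] off [c] common to both would close
     it into a cycle with all [m] hyperedges. *)
  apply/negP; rewrite inE => /andP[_ /set0Pn[y]]; rewrite !inE mem_q.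
  move=> /and3P[ya yf yc].
  have yp : inl y \notin p' ++ [:: inl v; inr f].
    apply: contra yc; rewrite -[inl y \in c](mem_rot j) cj mem_cat !inE /= orbF.
    by rewrite orbC.
  apply: (no_full_cycle m2 (cycle_of_epath ej ya yf yp)).
    by apply: subset_trans XF; rewrite -Xj; apply/subsetP => e; rewrite !inE.
  by rewrite -Xm -Xj; apply: eq_card => e; rewrite !inE.
have cQ : #|nx @: Q| = #|Q|.
  apply: card_in_imset => u v /nxE[nu _ _] /nxE[nv _ _] uv.
  have : next c (inl u) = next c (inl v) by rewrite nu nv uv.
  by move/(can_inj (prev_next uqc)) => -[].
have dA : A :&: nx @: Q = set0.
  apply/setP => e; rewrite in_setI in_set0; apply/negP => /andP[eA /imsetP[v /nxE[_ _]]].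
  by move=> nA ee; rewrite -ee eA in nA.
have : #|A :|: nx @: Q| <= m.
  rewrite -Xm; apply/subset_leq_card; rewrite subUset AX /=.
  by apply/subsetP => e /imsetP[v /nxE[_ ? _] ->].
rewrite cardsU dA cards0 subn0 cQ => aq.
move: (#|A|) (#|Q|) (#|U|) ap sup lt Q2 aq => na nq nu ap sup lt Q2 aq.
(* Expanding [h3] gives [(s - l.-1) * nq < l.-1]. As [s >= l + 3], this forces [4 * nq < l.-1],
   against [l <= nq.*2]. *)
have h1 : s * na <= s * (l.-1 - nq) by rewrite leq_mul2l; lia.
have h2 : l.-1 * (s.-1 - nq) <= l.-1 * nu by rewrite leq_mul2l; lia.
have h3 : l.-1 * (s.-1 - nq) < s * (l.-1 - nq) by lia.
nia.
Qed.

(** This is the crossing argument for Hamiltonian cycles. Both end hyperedges contain at least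
    [l / 2] inner vertices of the path, so some hyperedge [f] is preceded by a vertex of [tau b] and
    followed by a vertex of [tau a]. Bypassing [f] gives a cycle through all other hyperedges. *)
Lemma no_longest_path a b p : 2 <= m -> epath tau F a b p ->
  #|edges_of (inr a :: p)| = m -> False.
Proof.
move=> m2 ep Xm; have [pp lp up Fp] := ep.
set X := edges_of _ in Fp Xm; set w := inr a :: p in up.
have s0 : 0 < s by lia.
have [q eq_ Eq] := epath_rev ep.
have Xq : edges_of (inr b :: q) = X.
  by rewrite Eq; apply: edges_of_eq => z; rewrite mem_rev.
have qp v : (inl v \in q) = (inl v \in p).
  have : inl v \in inr b :: q = (inl v \in inr a :: p) by rewrite Eq mem_rev.
  by rewrite !inE.
set P := [set v in tau b | inl v \in p].
set P' := [set v in tau a | inl v \in p].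
have P2 : l <= #|P|.*2.
  by have [ap sup lt _] := last_edge_bounds m2 ep Xm; apply: (bounds_double s0 ap sup lt).
have P2' : l <= #|P'|.*2.
  have Xqm : #|edges_of (inr b :: q)| = m by rewrite Xq.
  have [ap sup lt _] := last_edge_bounds m2 eq_ Xqm.
  have := bounds_double s0 ap sup lt.
  by rewrite (_ : [set v in tau a | inl v \in q] = P') //; apply/setP=> v; rewrite !inE qp.
pose nx v := edge_at a (next w (inl v)).
pose pv v := edge_at a (prev w (inl v)).
have nxE v : inl v \in p -> [/\ next w (inl v) = inr (nx v),
    prev w (inl v) = inr (pv v), nx v \in X & pv v \in X].
  move=> vp; have [w1 [h [f [w2 Ew]]]] := vertex_split pp lp vp.
  have nv : next w (inl v) = inr f.
    by rewrite /w Ew -cat_rcons next_split // cat_rcons -Ew.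
  have hv : prev w (inl v) = inr h by rewrite /w Ew prev_split // -Ew.
  rewrite /nx /pv nv hv !inE; split=> //.
    by rewrite -[X in _ || X]/(inr f \in p) -in_cons Ew mem_cat !inE eqxx !orbT.
  by rewrite -in_cons Ew mem_cat !inE eqxx !orbT.
have cN : #|nx @: P| = #|P|.
  apply: card_in_imset => u v; rewrite !inE => /andP[_ /nxE[nu _ _ _]] /andP[_ /nxE[nv _ _ _]] uv.
  have : next w (inl u) = next w (inl v) by rewrite nu nv uv.
  by move/(can_inj (prev_next up)) => -[].
have cP : #|pv @: P'| = #|P'|.
  apply: card_in_imset => u v; rewrite !inE => /andP[_ /nxE[_ nu _ _]] /andP[_ /nxE[_ nv _ _]] uv.
  have : prev w (inl u) = prev w (inl v) by rewrite nu nv uv.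
  by move/(can_inj (next_prev up)) => -[].
have : #|nx @: P :|: pv @: P'| <= m.
  rewrite -Xm; apply/subset_leq_card; rewrite subUset; apply/andP.
  by split; apply/subsetP => e /imsetP[v]; rewrite inE => /andP[_ /nxE[]] _ _ ? ? ->.
rewrite cardsU cN cP => le_m.
(* The two images have together at least [l > m] elements inside a set of size [m]. *)
have : 0 < #|nx @: P :&: pv @: P'| by lia.
rewrite card_gt0 => /set0Pn[f]; rewrite inE => /andP[].
move=> /imsetP[x]; rewrite inE => /andP[xb xp] fx.
move=> /imsetP[y]; rewrite inE => /andP[ya yp] fy.
have [nx_ _ fX _] := nxE _ xp; have [_ py _ _] := nxE _ yp.
have [w1 [f' [h [w2 Ew]]]] := vertex_split pp lp yp.
have Ef : f' = f.
  by move: py; rewrite /w Ew prev_split -?Ew // -fy => -[].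
subst f'.
have [w1' [g Ew1]] : exists w1' g, w1 = w1' ++ [:: inr g; inl x].
  have [w3 [g [f' [w4 Ew3]]]] := vertex_split pp lp xp.
  have Ef' : f' = f.
    have : next w (inl x) = inr f'.
      by rewrite /w Ew3 -cat_rcons next_split // cat_rcons -Ew3.
    by rewrite nx_ -fx => -[].
  exists w3, g; subst f'.
  have E13 : w1 ++ inr f :: (inl y :: inr h :: w2) =
    (w3 ++ [:: inr g; inl x]) ++ inr f :: w4 by rewrite -Ew Ew3 -catA.
  by have [] := cat_uniq_inj _ E13; rewrite -?Ew.
have uw : uniq (w1 ++ inr f :: inl y :: inr h :: w2) by rewrite -Ew.
have so : sorted (inc tau) (w1 ++ inr f :: inl y :: inr h :: w2) by rewrite -Ew.
have lw2 : last (inr h) w2 = inr b.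
  have : last (inr a) (inr a :: p) = inr b by [].
  by rewrite Ew last_cat /=.
have [w0 Ew0] : exists w0, w1 = inr a :: w0.
  by case: (w1) Ew Ew1 => [|z w0] [-> _]; [case: w1'|exists w0].
have lw0 : last (inr a) w0 = inl x.
  by have : last (inr a) w1 = inl x; [rewrite Ew1 last_cat|rewrite Ew0].
move: so; rewrite Ew0 /= cat_path lw0 /= => /and4P[pw0 xf _ /andP[yh pw2]].
(* The cycle goes from [y] forward to [b], jumps to [x], goes back to [a], and closes at [y]; only
   [f] is skipped. *)
pose c := inl y :: inr h :: w2 ++ rev w1.
have cw z : (z \in c) = (z != inr f) && (z \in w).
  rewrite /w Ew /c !inE !mem_cat mem_rev !inE.
  have [->|_] := eqVneq z (inr f); last first.
    by case: (z \in w1); rewrite /= ?orbT ?orbF.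
  move: uw; rewrite cat_uniq /= !inE !negb_or.
  by move=> /and3P[_ /andP[/negPf-> _] /andP[/and3P[_ /negPf-> /negPf->]]].
apply: (@no_near_full_cycle X c f x m2 Xm Fp).
- by rewrite fx.
- apply/andP; split.
    rewrite /c /= rcons_cat cat_path lw2.
    rewrite yh pw2 -rev_cons -[inr b](last_rcons (inl y) w1).
    rewrite -[inl y :: w1](belast_rcons (inl y) w1 (inr b)) rev_path.
    rewrite (@eq_path _ _ (inc tau)); last by move=> ? ?; rewrite inc_sym.
    by rewrite Ew0 /= ya rcons_path pw0 lw0.
  have sub : subseq (w1 ++ inl y :: inr h :: w2) (w1 ++ inr f :: inl y :: inr h :: w2).
    by apply: cat_subseq => //; apply: subseq_cons.
  rewrite -(@perm_uniq _ (w1 ++ inl y :: inr h :: w2)).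
    exact: subseq_uniq sub uw.
  by apply/permP => T; rewrite /c -2!cat_cons !count_cat count_rev addnC.
- by apply/setP => e; rewrite in_set in_setD1 cw !inE.
- by [].
- by rewrite cw /= in_cons xp orbT.
Qed.

End Longest.

(** * Counting hyperedges without a long Berge path *)

Lemma epath_sub (V E : finType) (tau : E -> {set V}) (F F' : {set E}) a b p :
  F' \subset F -> epath tau F' a b p -> epath tau F a b p.
Proof. by move=> FF [? ? ? Fp]; split=> //; apply: subset_trans FF. Qed.

(** By induction on [#|F|]: a set [S] touched by few hyperedges is deleted together with them. If no
    such [S] exists, the expansion hypothesis holds, and the absence of paths with [l] hyperedges
    descends to shorter lengths until it contradicts the existence of a single hyperedge. *)
Lemma card_edges_le (V E : finType) (tau : E -> {set V}) (l s : nat) (F : {set E}) :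
  3 <= l -> l + 3 <= s ->
  (forall e, e \in F -> s <= #|tau e|.+1) ->
  (forall e f, e \in F -> f \in F -> e != f -> s <= #|tau e :|: tau f|) ->
  (forall a b p, epath tau F a b p -> #|edges_of (inr a :: p)| <> l) ->
  s * #|F| <= l.-1 * #|\bigcup_(e in F) tau e|.
Proof.
move=> l3 sl; have [n] := ubnP #|F|; elim: n F => // n IHn F Fn sz sz2 free.
have [/existsP[S /and3P[S0 SF Sle]]|] := boolP [exists S : {set V},
  [&& S != set0, S \subset \bigcup_(e in F) tau e &
      s * #|touching tau F S| <= l.-1 * #|S|]].
  set N := touching tau F S in Sle.
  have NF : N \subset F by apply/subsetP => e; rewrite inE => /andP[].
  have /set0Pn[v vS] := S0.
  have /bigcupP[e eF ve] := subsetP SF _ vS.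
  have eN : e \in N by apply: mem_touching vS.
  have FD : F :\: N \subset F := subsetDl _ _.
  have cF : #|F| = #|F :\: N| + #|N|.
    by rewrite -(cardsID N F) (setIidPr NF) addnC.
  have N0 : 0 < #|N| by rewrite card_gt0; apply/set0Pn; exists e.
  have := IHn (F :\: N) _ _ _ _.
  move=> IH; have {}IH : s * #|F :\: N| <= l.-1 * #|\bigcup_(e in F :\: N) tau e|.
    apply: IH; first by lia.
    - by move=> f /(subsetP FD); apply: sz.
    - by move=> f g /(subsetP FD) fF /(subsetP FD); apply: sz2.
    - by move=> a b p /(epath_sub FD); apply: free.
  have : #|\bigcup_(e in F :\: N) tau e| + #|S| <= #|\bigcup_(e in F) tau e|.
    rewrite -(cardsID S (\bigcup_(e in F) tau e)) (setIidPr SF) addnC leq_add2l.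
    apply/subset_leq_card/subsetP => u /bigcupP[f].
    rewrite inE => /andP[fN fF] uf; rewrite inE; apply/andP; split.
      by apply: contra fN => uS; apply: mem_touching uS.
    by apply/bigcupP; exists f.
  move=> le; have := leq_mul (leqnn l.-1) le; rewrite mulnDr cF mulnDr; lia.
move=> /existsPn ex.
have expand S : S != set0 -> S \subset \bigcup_(e in F) tau e ->
    l.-1 * #|S| < s * #|touching tau F S|.
  by move=> S0 SF; have := ex S; rewrite S0 SF /= -ltnNge.
have [->|/set0Pn[e eF]] := eqVneq F set0; first by rewrite cards0 muln0.
suff : forall m, 0 < m <= l ->
    (forall a b p, epath tau F a b p -> #|edges_of (inr a :: p)| <> m) -> False.
  by move=> /(_ l)[] //; lia.
have e1 f : edges_of ([:: inr f] : seq (V + E)) = [set f].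
  by apply/setP => g; rewrite !inE.
have ep1 f : f \in F -> epath tau F f f [::].
  by move=> fF; split=> //; rewrite (e1 f) sub1set.
elim=> // [[|m] IHm] ml free_m.
  by apply: (free_m _ _ _ (ep1 e eF)); rewrite e1 cards1.
apply: IHm; first by lia.
move=> a b p ep pm.
case: m ml free_m pm => [|m] ml free_m pm; last first.
  have ml' : m.+2 < l by lia.
  exact: (@no_longest_path V E tau F l s m.+2 l3 sl isT ml' sz sz2 expand free_m a b p isT ep pm).
(* Length one is treated apart: without paths of two hyperedges the traces are pairwise disjoint, so
   [tau e] is touched by [e] alone. This violates [expand], since [l.-1 >= 2] and
   [#|tau e| >= s.-1]. *)
have te0 : tau e != set0 by rewrite -card_gt0; have := sz e eF; lia.
have := expand _ te0 (bigcup_sup _ eF); have := sz _ eF.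
suff -> : touching tau F (tau e) = [set e] by rewrite cards1; nia.
apply/setP => f; rewrite in_set1; apply/idP/eqP => [|->]; last first.
  by have /set0Pn[v ve] := te0; apply: (mem_touching eF ve ve).
rewrite inE => /andP[fF /set0Pn[v]]; rewrite inE => /andP[vf ve].
apply/eqP; apply: contraT => fe.
have fne : inr f \notin [:: inr e : V + E] by rewrite inE.
have [ep' E'] := epath_extend (ep1 _ eF) ve isT fF vf fne.
by case: (free_m _ _ _ ep'); rewrite E' e1 cardsU1 cards1 in_set1 fe.
Qed.

(** * Berge embeddings *)

Section BergeIn.
Variable V : finType.

(* A Berge-[G] with its vertices in [W] and its hyperedges in [H], where [psi x y]
   is the hyperedge assigned to the edge [xy]. *)
Definition berge_in (G : sgraph) (W : {set V}) (H : {set {set V}}) : Prop :=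
  exists (f : G -> V) (psi : G -> G -> {set V}),
  [/\ injective f, forall x, f x \in W,
      forall x y, adj x y -> [/\ psi x y \in H, f x \in psi x y & psi x y = psi y x]
    & forall x y x' y', adj x y -> adj x' y' -> psi x y = psi x' y' ->
        [set x; y] = [set x'; y']].

Lemma set2_inj (T : finType) (x y u v : T) : x != y -> [set x; y] = [set u; v] ->
  (x = u /\ y = v) \/ (x = v /\ y = u).
Proof.
move=> xy /setP E; have := E x; have := E y.
rewrite !inE !eqxx !orbT /=.
move=> /esym/orP[/eqP yu|/eqP yv] /esym/orP[/eqP xu|/eqP xv].
- by rewrite xu yu eqxx in xy.
- by right.
- by left.
- by rewrite xv yv eqxx in xy.
Qed.

Lemma contains_berge_in (G : sgraph) (W : {set V}) (H : {set {set V}}) :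
  berge_in G W H -> contains_berge G H.
Proof.
move=> [f [psi [finj _ psiP psi_inj]]].
(* An unordered edge is given an arbitrary orientation by [pick]; the symmetry of [psi] makes the
   value independent of the choice. *)
pose phi : {ffun {set G} -> {set V}} := [ffun e : {set G} =>
  if [pick p : G * G | adj p.1 p.2 && (e == [set p.1; p.2])] is Some p
  then psi p.1 p.2 else set0].
have phiE x y : adj x y -> phi [set x; y] = psi x y.
  move=> xy; rewrite ffunE; case: pickP => [[u v]/=|/(_ (x, y))]; last first.
    by rewrite /= xy eqxx.
  move=> /andP[uv /eqP exy].
  have nxy : x != y by apply: contraTneq xy => ->; rewrite adj_irr.
  have [[-> ->]//|[-> ->]] := set2_inj nxy exy.
  by have [] := psiP _ _ uv.
apply/existsP; exists (phi @: edges G); apply/andP; split.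
  apply/subsetP => e /imsetP[_ /imsetP[[x y]] + ->] ->.
  by rewrite inE /= => xy; rewrite phiE //; have [] := psiP _ _ xy.
apply/existsP; exists (finfun f); apply/existsP; exists phi; apply/and4P; split => //.
- by apply/injectiveP => x y; rewrite !ffunE => /finj.
- apply/dinjectiveP => _ _ /imsetP[[x y]] + -> /imsetP[[x' y']] + ->.
  by rewrite !inE /= => xy xy'; rewrite !phiE //; apply: psi_inj.
- apply/forallP => e; apply/implyP => /imsetP[[x y]]; rewrite inE /= => xy ->.
  rewrite phiE //; apply/subsetP => _ /imsetP[z + ->]; rewrite ffunE.
  have [_ fx Es] := psiP _ _ xy.
  have [_ fy _] := psiP y x (etrans (adj_sym _ _) xy).
  by rewrite !inE => /orP[]/eqP-> //; rewrite Es.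
Qed.

Lemma imset_set2 (T T' : finType) (f : T -> T') x y : f @: [set x; y] = [set f x; f y].
Proof. by rewrite imsetU !imset_set1. Qed.

Lemma berge_in_dunion (G G' : sgraph) (W W' : {set V}) (H H' : {set {set V}}) :
  [disjoint W & W'] -> [disjoint H & H'] ->
  berge_in G W H -> berge_in G' W' H' ->
  berge_in (dunion G G') (W :|: W') (H :|: H').
Proof.
move=> dW dH [f [psi [finj fW psiP psi_inj]]] [f' [psi' [finj' fW' psiP' psi_inj']]].
exists (fun z => match z with inl x => f x | inr x => f' x end).
exists (fun z t => match z, t with
  | inl x, inl y => psi x y | inr x, inr y => psi' x y | _, _ => set0 end).
have dWx x : x \in W -> x \notin W' by move=> xW; rewrite (disjointFr dW xW).
have dHx x : x \in H -> x \notin H' by move=> xH; rewrite (disjointFr dH xH).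
split.
- move=> [x|x] [y|y] E.
  + by rewrite (finj _ _ E).
  + by have := dWx _ (fW x); rewrite E fW'.
  + by have := dWx _ (fW y); rewrite -E fW'.
  + by rewrite (finj' _ _ E).
- by case=> x; rewrite inE ?fW ?fW' ?orbT.
- move=> [x|x] [y|y] //= xy.
  + by have [h1 h2 h3] := psiP _ _ xy; split=> //; rewrite inE h1.
  + by have [h1 h2 h3] := psiP' _ _ xy; split=> //; rewrite inE h1 orbT.
- move=> [x|x] [y|y] [u|u] [v|v] //= xy uv E.
  + by rewrite -!imset_set2 (psi_inj _ _ _ _ xy uv E).
  + have [h1 _ _] := psiP _ _ xy; have [h2 _ _] := psiP' _ _ uv.
    by have := dHx _ h1; rewrite E h2.
  + have [h1 _ _] := psiP' _ _ xy; have [h2 _ _] := psiP _ _ uv.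
    by have := dHx _ h2; rewrite -E h1.
  + by rewrite -!imset_set2 (psi_inj' _ _ _ _ xy uv E).
Qed.

Lemma berge_in_copies0 (G : sgraph) : berge_in (copies 0 G) set0 set0.
Proof.
have absurd (A : Type) (z : 'I_0 * G) : A by case: z => [[]].
by exists (absurd _), (fun _ => absurd _); split => x; apply: absurd.
Qed.

Lemma berge_in_copiesS (G : sgraph) c (W W' : {set V}) (H H' : {set {set V}}) :
  [disjoint W & W'] -> [disjoint H & H'] ->
  berge_in G W H -> berge_in (copies c G) W' H' ->
  berge_in (copies c.+1 G) (W :|: W') (H :|: H').
Proof.
move=> dW dH [f [psi [finj fW psiP psi_inj]]] [f' [psi' [finj' fW' psiP' psi_inj']]].
exists (fun z : 'I_c.+1 * G => if unlift ord0 z.1 is Some i then f' (i, z.2) else f z.2).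
exists (fun z t : 'I_c.+1 * G =>
  if unlift ord0 z.1 is Some i then psi' (i, z.2) (i, t.2) else psi z.2 t.2).
have dWx x : x \in W -> x \notin W' by move=> xW; rewrite (disjointFr dW xW).
have dHx x : x \in H -> x \notin H' by move=> xH; rewrite (disjointFr dH xH).
split.
- move=> [i x] [j y] /=; case: unliftP => [i'|] ->; case: unliftP => [j'|] -> E.
  + by case: (finj' _ _ E) => -> ->.
  + by have := dWx _ (fW y); rewrite -E fW'.
  + by have := dWx _ (fW x); rewrite E fW'.
  + by rewrite (finj _ _ E).
- by move=> [i x] /=; case: unliftP => [i'|] _; rewrite inE ?fW ?fW' ?orbT.
- move=> [i x] [j y] /andP[/= /eqP <-{j} xy]; case: unliftP => [i'|] _.
    have xy' : @adj (copies c G) (i', x) (i', y) by rewrite /= /copies_adj /= eqxx.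
    by have [h1 h2 h3] := psiP' _ _ xy'; split=> //; rewrite inE h1 orbT.
  by have [h1 h2 h3] := psiP _ _ xy; split=> //; rewrite inE h1.
- move=> [i x] [j y] [i2 x2] [j2 y2] /andP[/= /eqP <-{j} xy] /andP[/= /eqP <-{j2} xy2].
  case: unliftP => [i'|] ->; case: unliftP => [i2'|] -> E.
  + have xy' : @adj (copies c G) (i', x) (i', y) by rewrite /= /copies_adj /= eqxx.
    have xy2' : @adj (copies c G) (i2', x2) (i2', y2) by rewrite /= /copies_adj /= eqxx.
    have := congr1 (fun S : {set copies c G} => (fun z => (lift ord0 z.1, z.2)) @: S)
      (psi_inj' _ _ _ _ xy' xy2' E).
    by rewrite /= !imset_set2.
  + have xy' : @adj (copies c G) (i', x) (i', y) by rewrite /= /copies_adj /= eqxx.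
    have [h1 _ _] := psiP' _ _ xy'; have [h2 _ _] := psiP _ _ xy2.
    by have := dHx _ h2; rewrite -E h1.
  + have xy' : @adj (copies c G) (i2', x2) (i2', y2) by rewrite /= /copies_adj /= eqxx.
    have [h1 _ _] := psiP' _ _ xy'; have [h2 _ _] := psiP _ _ xy.
    by have := dHx _ h2; rewrite E h1.
  + have := congr1 (fun S : {set G} => (fun z => (ord0 : 'I_c.+1, z)) @: S)
      (psi_inj _ _ _ _ xy xy2 E).
    by rewrite /= !imset_set2.
Qed.

End BergeIn.

(** It separates an alternating path into its vertices and its hyperedges. Each step consumes a
    hyperedge and a vertex, hence the induction on a bound [n] for the length; [e0] is only a
    default for [nth]. *)
Lemma vpath_seqs (V E : finType) (tau : E -> {set V}) (e0 : E) n q v u :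
  size q <= n -> path (inc tau) (inl v) q -> last (inl v) q = inl u ->
  uniq (inl v :: q) ->
  exists vs es, [/\ size vs = size es, uniq (v :: vs) && uniq es,
    forall x, (x \in vs) = (inl x \in q), forall e, (e \in es) = (inr e \in q)
    & forall x i, i < size es -> nth x (v :: vs) i \in tau (nth e0 es i) /\
        nth x vs i \in tau (nth e0 es i)].
Proof.
elim: n q v => [|n IHn] [|[x|e] q] v //= szq.
- by move=> _ _ _; exists [::], [::].
- by move=> _ _ _; exists [::], [::].
case: q szq => [|[x|f] q] szq //=; last by rewrite andbF.
move=> /and3P[ve xe pq] lq /and3P[vq eq_ /andP[xq uq]].
have [|//|//||vs [es [szv /andP[uvs ues] vsP esP nthE]]] := IHn q x.
- by move: szq => /=; lia.
- by rewrite /= xq.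
have vxs : v \notin x :: vs.
  by rewrite inE vsP; move: vq; rewrite !inE.
have ees : e \notin es by rewrite esP; move: eq_; rewrite !inE.
exists (x :: vs), (e :: es); split.
- by rewrite /= szv.
- by rewrite cons_uniq vxs /= ees ues; move: uvs => /= ->.
- by move=> y; rewrite !inE vsP.
- by move=> f; rewrite !inE esP.
- by move=> y [_|i ii]; [|apply: nthE].
Qed.

(** * Berge paths and stars from sequences *)

Section Embeddings.
Variable V : finType.

Lemma berge_in_sub (G : sgraph) (W W' : {set V}) (H H' : {set {set V}}) :
  W \subset W' -> H \subset H' -> berge_in G W H -> berge_in G W' H'.
Proof.
move=> WW HH [f [psi [finj fW psiP psi_inj]]]; exists f, psi; split=> //.
- by move=> x; apply: (subsetP WW).
- by move=> x y /psiP[h1 h2 h3]; split=> //; apply: (subsetP HH).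
Qed.

Lemma berge_in_path l (x0 : V) (e0 : {set V}) vs es :
  size vs = l.+1 -> size es = l -> uniq vs -> uniq es ->
  (forall i, i < l -> nth x0 vs i \in nth e0 es i /\ nth x0 vs i.+1 \in nth e0 es i) ->
  berge_in (path_graph l) [set x in vs] [set e in es].
Proof.
move=> szv sze uv ue incl.
exists (fun i : 'I_l.+1 => nth x0 vs i), (fun i j : 'I_l.+1 => nth e0 es (minn i j)).
have min_lt (i j : 'I_l.+1) : path_adj i j -> minn i j < l.
  by rewrite /path_adj; have := ltn_ord i; have := ltn_ord j; lia.
split.
- move=> i j /eqP; rewrite nth_uniq ?szv ?ltn_ord // => /eqP; exact: val_inj.
- by move=> i; rewrite inE mem_nth // szv.
- move=> i j ij; have lt := min_lt i j ij; rewrite inE mem_nth ?sze //.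
  split=> //; last by rewrite minnC.
  case/orP: (ij) => /eqP E; first by rewrite (minn_idPl _) ?(incl i _).1 //; lia.
  by rewrite (minn_idPr _); [rewrite -E; apply: (incl j _).2|]; lia.
- move=> i j i' j' ij ij' /eqP; rewrite nth_uniq ?sze ?min_lt // => /eqP E.
  have [[]|[]] : (i = i' :> nat /\ j = j' :> nat) \/ (i = j' :> nat /\ j = i' :> nat).
    move: ij ij'; rewrite /= /path_adj; lia.
  + by move=> /val_inj-> /val_inj->.
  + by move=> /val_inj-> /val_inj->; rewrite setUC.
Qed.

Lemma berge_in_star l (c : V) (e0 : {set V}) vs es :
  size vs = l -> size es = l -> uniq (c :: vs) -> uniq es ->
  (forall i, i < l -> c \in nth e0 es i /\ nth c vs i \in nth e0 es i) ->
  berge_in (star_graph l) [set x in c :: vs] [set e in es].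
Proof.
move=> szv sze uv ue incl.
exists (fun i : 'I_l.+1 => nth c (c :: vs) i), (fun i j : 'I_l.+1 => nth e0 es (maxn i j).-1).
have adjE (i j : 'I_l.+1) : star_adj i j = ((i == 0 :> nat) != (j == 0 :> nat)) by [].
have max_lt (i j : 'I_l.+1) : star_adj i j -> (maxn i j).-1 < l.
  by rewrite adjE; have := ltn_ord i; have := ltn_ord j; lia.
split.
- move=> i j /eqP; rewrite nth_uniq ?[size _]/= ?szv ?ltn_ord // => /eqP; exact: val_inj.
- by move=> i; rewrite inE mem_nth //= szv.
- move=> i j ij; have lt := max_lt i j ij; rewrite inE mem_nth ?sze //.
  split=> //; last by rewrite maxnC.
  case: i ij lt => [[|i] Hi] ij lt; first exact: (incl _ lt).1.
  have j0 : j = 0 :> nat by move: ij; rewrite /= adjE /=; lia.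
  by move: lt; rewrite j0 maxn0 => lt; apply: (incl _ lt).2.
- move=> i j i' j' ij ij' /eqP; rewrite nth_uniq ?sze ?max_lt // => /eqP E.
  have [[]|[]] : (i = i' :> nat /\ j = j' :> nat) \/ (i = j' :> nat /\ j = i' :> nat).
    move: ij ij' E; rewrite /= !adjE; lia.
  + by move=> /val_inj-> /val_inj->.
  + by move=> /val_inj-> /val_inj->; rewrite setUC.
Qed.

(** The path lacks only its two end vertices. It has fewer than [l] inner vertices, so traces with
    more than [l] elements leave room for [x] in the first hyperedge and then for a different [y] in
    the last one. *)
Lemma berge_in_epath (tau : {set V} -> {set V}) (F : {set {set V}}) l a b p :
  0 < l -> (forall e, tau e \subset e) -> (forall e, e \in F -> l < #|tau e|) ->
  epath tau F a b p -> #|edges_of (inr a :: p)| = l ->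
  let X := edges_of (inr a :: p) in
  berge_in (path_graph l) (\bigcup_(e in X) tau e) X.
Proof.
move=> l0 tau_sub sz ep Xl X; have [pp lp up Fp] := ep.
have vm := card_vertices ep; rewrite Xl in vm.
set S := [set v | inl v \in p] in vm.
have aX : a \in X by rewrite inE mem_head.
have bX : b \in X by rewrite inE -lp mem_last.
have [x xa xp] : exists2 x, x \in tau a & x \notin S.
  apply/subsetPn; apply: contraTN (sz _ (subsetP Fp _ aX)) => /subset_leq_card.
  by rewrite -leqNgt; lia.
have [y yb] : exists2 y, y \in tau b & y \notin x |: S.
  apply/subsetPn; apply: contraTN (sz _ (subsetP Fp _ bX)) => /subset_leq_card.
  by rewrite cardsU1 xp -leqNgt; lia.
rewrite !inE negb_or => /andP[yx yp]; rewrite inE in xp.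
set q := inr a :: rcons p (inl y).
have pq : path (inc tau) (inl x) q by rewrite /= xa rcons_path pp lp.
have lq : last (inl x) q = inl y by rewrite /= last_rcons.
have uq : uniq (inl x :: q).
  rewrite /q -rcons_cons cons_uniq rcons_uniq up mem_rcons !inE !negb_or.
  by rewrite /= xp yp !andbT eq_sym.
have [vs [es [szv /andP[uvs ues] vsP esP nthE]]] := vpath_seqs a (leqnn _) pq lq uq.
have EX : [set e in es] = X.
  by apply/setP => e; rewrite inE esP /q -rcons_cons mem_rcons !inE.
have szl : size es = l.
  by rewrite -Xl -(card_uniqP ues) -/X -EX; apply: eq_card => e; rewrite inE.
have mem_es i : i < l -> nth a es i \in X by move=> il; rewrite -EX inE mem_nth // szl.
have nthl i : i < l -> nth x (x :: vs) i \in tau (nth a es i) /\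
    nth x (x :: vs) i.+1 \in tau (nth a es i) by move=> il; apply: nthE; rewrite szl.
rewrite -[X in berge_in _ _ X]EX.
apply: (@berge_in_sub _ [set z in x :: vs] _ [set e in es]) => //.
  apply/subsetP => z; rewrite inE => /(nthP x)[[|i] /=].
    by move=> _ <-; apply/bigcupP; exists (nth a es 0); [apply: mem_es|apply: (nthl 0 l0).1].
  rewrite szv szl ltnS => il <-; apply/bigcupP; exists (nth a es i); first exact: mem_es.
  exact: (nthl i il).2.
apply: (@berge_in_path _ x a) => //; first by rewrite /= szv szl.
by move=> i il; have [h1 h2] := nthl i il; split; apply: (subsetP (tau_sub _)).
Qed.

(** The star grows one leaf at a time; [vs] and [es] are the leaves and hyperedges used so far, and
    the hypothesis supplies the next pair. *)
Lemma greedy_star l (c : V) (H : {set {set V}}) (A : {set V}) :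
  (forall (vs : seq V) (es : seq {set V}), size vs < l -> size es = size vs ->
    exists e v, [/\ e \in H, e \notin es, c \in e, v \in e & v \in A /\ v \notin c :: vs]) ->
  exists W Hs, [/\ berge_in (star_graph l) W Hs, W \subset c |: A, Hs \subset H,
    #|W| <= l.+1 & #|Hs| <= l].
Proof.
move=> step.
suff /(_ l (leqnn l)) [vs [es [szv sze uv ue [incl vA eH]]]] : forall j, j <= l ->
    exists (vs : seq V) (es : seq {set V}), [/\ size vs = j, size es = j,
    uniq (c :: vs), uniq es & [/\ forall i, i < j -> c \in nth set0 es i /\
    nth c vs i \in nth set0 es i, {subset vs <= A} & {subset es <= H}]].
  exists [set x in c :: vs], [set e in es]; split.
  - exact: berge_in_star incl.
  - by apply/subsetP => x; rewrite !inE => /orP[->//|/vA->]; rewrite orbT.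
  - by apply/subsetP => e; rewrite inE => /eH.
  - by rewrite cardsE; apply: leq_trans (card_size _) _; rewrite /= szv.
  - by rewrite cardsE; apply: leq_trans (card_size _) _; rewrite sze.
elim=> [_|j IHj jl]; first by exists [::], [::].
have [vs [es [szv sze uv ue [incl vA eH]]]] := IHj (ltnW jl).
have [||e [v [eH' ees ce ve [vA' vvs]]]] := step vs es; rewrite ?szv //.
exists (rcons vs v), (rcons es e); split; rewrite ?size_rcons ?szv ?sze //.
- by rewrite -rcons_cons rcons_uniq vvs.
- by rewrite rcons_uniq ees.
split.
- move=> i ij; rewrite !nth_rcons szv sze; case: ltngtP => [||_ //]; last lia.
  by move=> /incl.
- by move=> x; rewrite mem_rcons inE => /orP[/eqP->//|/vA].
- by move=> x; rewrite mem_rcons inE => /orP[/eqP->//|/eH].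
Qed.

End Embeddings.

(** * Upper bound *)

Section Upper.
Variable V : finType.
Implicit Types (H : {set {set V}}) (K W Z : {set V}).

Lemma card_bigcup_le (I T : finType) (P : {set I}) (B : I -> {set T}) d :
  (forall i, i \in P -> #|B i| <= d) -> #|\bigcup_(i in P) B i| <= #|P| * d.
Proof.
move=> Bd; rewrite -sum_nat_const.
apply: (@leq_trans (\sum_(i in P) #|B i|)); last exact: leq_sum.
elim/big_rec2: _ => [|i n S _ le]; first by rewrite cards0.
by apply: leq_trans (leq_card_setU _ _) _; rewrite leq_add2l.
Qed.

Definition deg H (v : V) := #|[set e in H | v \in e]|.

Lemma sum_card_setD H K :
  \sum_(e in H) #|e :\: K| = \sum_(v in ~: K) deg H v.
Proof.
under eq_bigr => e _ do rewrite -sum1_card.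
rewrite (exchange_big_dep (fun v => v \in ~: K)) /=; last first.
  by move=> e v _; rewrite !inE => /andP[].
apply: eq_bigr => v; rewrite inE => vK; rewrite /deg -sum1_card.
by apply: eq_bigl => e; rewrite !inE vK.
Qed.

(** Discarding the hyperedges that meet [Z] outside [K] costs at most [#|Z| * D]. What remains has
    average degree above [l.-1] outside [K], hence a centre of degree at least [l], and every
    hyperedge has more than [l] candidates for leaves. The star and its hyperedges are then added to
    [Z]. *)
Lemma far_stars H K r s D l : 0 < l -> l < s ->
  (forall e, e \in H -> s <= #|e :\: K| /\ #|e| <= r) ->
  (forall v, v \notin K -> deg H v <= D) ->
  forall j Z,
  l.-1 * #|V| + s * (D * (#|Z| + j * (l * r + l.+1))) < s * #|H| ->
  exists W Hs, [/\ berge_in (copies j (star_graph l)) W Hs,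
    W \subset ~: (K :|: Z), Hs \subset H &
    forall e, e \in Hs -> [disjoint e :\: K & Z]].
Proof.
move=> l0 ls szH degD; elim=> [|j IHj] Z bound.
  exists set0, set0; split; rewrite ?sub0set //; first exact: berge_in_copies0.
  by move=> e; rewrite inE.
pose H' := [set e in H | [disjoint e :\: K & Z]].
have HH' : #|H| <= #|H'| + #|Z| * D.
  have -> : H' = H :\: [set e in H | ~~ [disjoint e :\: K & Z]].
    by apply/setP => e; rewrite !inE negb_and negbK; case: (e \in H); rewrite ?andbF ?andbT.
  rewrite -(cardsID [set e in H | ~~ [disjoint e :\: K & Z]] H) addnC leq_add2l.
  apply: (@leq_trans #|\bigcup_(v in Z :\: K) [set e in H | v \in e]|).
    apply/subset_leq_card/subsetP => e; rewrite !inE => /and3P[_ eH].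
    rewrite -setI_eq0 => /set0Pn[v]; rewrite !inE => /andP[/andP[vK ve] vZ].
    by apply/bigcupP; exists v; rewrite !inE ?vK ?eH.
  apply: (@leq_trans (#|Z :\: K| * D)); last by rewrite leq_mul2r subset_leq_card ?orbT ?subsetDl.
  by apply: card_bigcup_le => v; rewrite inE => /andP[vK _]; apply: degD.
have [c cK cdeg] : exists2 c, c \notin K & l <= deg H' c.
  case: (pickP (fun c => (c \notin K) && (l <= deg H' c))) => [c /andP[]|none]; first by exists c.
  exfalso.
  have : s * #|H'| <= l.-1 * #|V|.
    apply: (@leq_trans (\sum_(e in H') #|e :\: K|)).
      by rewrite mulnC -sum_nat_const; apply: leq_sum => e; rewrite inE => /andP[/szH[]].
    rewrite sum_card_setD; apply: (@leq_trans (\sum_(v in ~: K) l.-1)).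
      by apply: leq_sum => v; rewrite inE => vK; have := none v; rewrite vK /=; lia.
    by rewrite sum_nat_const mulnC leq_mul2l max_card orbT.
  have := leq_mul (leqnn s) HH'; rewrite mulnDr.
  move: bound; rewrite (mulnDr D) (mulnDr s) (mulnC D #|Z|); lia.
have [e0 e0H] : exists e0, e0 \in [set e in H' | c \in e].
  by apply/set0Pn; rewrite -card_gt0; apply: leq_trans cdeg.
have cZ : c \notin Z.
  move: e0H; rewrite !inE => /andP[/andP[_ d] ce]; apply/negP => cZ.
  by have := disjointFl d cZ; rewrite inE cK ce.
have [W1 [Hs1 [star1 W1A Hs1H' cW1 cHs1]]] :
    exists W Hs, [/\ berge_in (star_graph l) W Hs, W \subset c |: ~: (K :|: Z),
      Hs \subset H', #|W| <= l.+1 & #|Hs| <= l].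
  apply: greedy_star => vs es szv sze.
  have [e] : exists2 e, e \in [set e in H' | c \in e] & e \notin es.
    apply/subsetPn; apply: contraTN cdeg => /subset_leq_card; rewrite -ltnNge.
    by move=> h; apply: leq_ltn_trans h _; apply: leq_ltn_trans (card_size _) _; rewrite sze.
  rewrite !inE => /andP[/andP[eH dZ] ce] ees.
  have [v] : exists2 v, v \in e :\: K & v \notin c :: vs.
    apply/subsetPn; apply: contraTN (szH e eH).1 => /subset_leq_card; rewrite -ltnNge.
    move=> h; apply: leq_ltn_trans h _; apply: leq_ltn_trans (card_size _) _ => /=.
    by lia.
  move=> veK vvs; have := disjointFr dZ veK; move: veK; rewrite !inE => /andP[vK ve] vZ.
  by exists e, v; rewrite !inE eH dZ negb_or vK vZ.
have {}W1A : W1 \subset ~: (K :|: Z).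
  apply: subset_trans W1A _; rewrite subUset subxx andbT sub1set !inE negb_or.
  by rewrite cK.
(* The star has at most [l.+1] vertices and [l] hyperedges of size at most [r], whence the summand
   [l * r + l.+1] per star in the bound. *)
pose Z2 := Z :|: (W1 :|: \bigcup_(e in Hs1) e).
have cZ2 : #|Z2| <= #|Z| + (l * r + l.+1).
  apply: leq_trans (leq_card_setU _ _) _; rewrite leq_add2l.
  apply: leq_trans (leq_card_setU _ _) _; rewrite addnC leq_add //.
  apply: (@leq_trans (#|Hs1| * r)); last by rewrite leq_mul2r cHs1 orbT.
  apply: card_bigcup_le => e /(subsetP Hs1H'); rewrite inE => /andP[/szH[]] //.
have [|W2 [Hs2 [star2 W2A Hs2H Hs2d]]] := IHj Z2.
  apply: leq_ltn_trans bound; rewrite leq_add2l leq_mul2l leq_mul2l mulSn.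
  by apply/orP; right; apply/orP; right; lia.
exists (W1 :|: W2), (Hs1 :|: Hs2); split.
- apply: berge_in_copiesS => //; rewrite -setI_eq0; apply/eqP/setP => x; rewrite !inE.
    apply/negP => /andP[xW1 /(subsetP W2A)]; rewrite !inE xW1 !orbT.
    by [].
  apply/negP => /andP[xH1 xH2].
  have /szH[+ _] := subsetP Hs2H _ xH2; move=> sx.
  have /set0Pn[v vx] : x :\: K != set0 by rewrite -card_gt0; lia.
  have := disjointFr (Hs2d _ xH2) vx; rewrite !inE => /negbT; rewrite !negb_or.
  move=> /and3P[_ _ /negP[]]; apply/bigcupP; exists x => //.
  by move: vx; rewrite inE => /andP[].
- rewrite subUset W1A /=; apply: subset_trans W2A _.
  by rewrite setCS setUS // subsetUl.
- rewrite subUset Hs2H andbT; apply: subset_trans Hs1H' _.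
  by apply/subsetP => e; rewrite inE => /andP[].
- move=> e; rewrite inE => /orP[/(subsetP Hs1H')|/Hs2d].
    by rewrite inE => /andP[].
  by apply: disjointWr; apply: subsetUl.
Qed.

Lemma centered_stars H l B (cs : seq V) W0 (H0 : {set {set V}}) :
  uniq cs -> {in cs, forall c, l + B + 2 ^ B <= deg H c} ->
  {in cs, forall c, c \notin W0} ->
  #|W0| + size cs * l.+2 <= B -> #|H0| + size cs * l <= B ->
  exists W Hs, [/\ berge_in (copies (size cs) (star_graph l)) W Hs,
    W \subset ~: W0 & Hs \subset H :\: H0].
Proof.
elim: cs W0 H0 => [|c cs IHcs] W0 H0 /=.
  by move=> *; exists set0, set0; split; rewrite ?sub0set //; apply: berge_in_copies0.
move=> /andP[ccs ucs] cdeg csW0 bW bH.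
have [W1 [Hs1 [star1 W1A Hs1H cW1 cHs1]]] :
    exists W Hs, [/\ berge_in (star_graph l) W Hs,
      W \subset c |: ~: (W0 :|: [set x in cs]),
      Hs \subset H :\: H0, #|W| <= l.+1 & #|Hs| <= l].
  apply: greedy_star => vs es szv sze.
  pose S := W0 :|: [set x in cs] :|: [set x in c :: vs].
  have cS : #|S| <= B.
    apply: leq_trans (leq_card_setU _ _) _.
    apply: (@leq_trans (#|W0| + size cs + (size vs).+1)); last by rewrite mulSn in bW; nia.
    rewrite leq_add //; last by rewrite cardsE; apply: leq_trans (card_size _) _.
    apply: leq_trans (leq_card_setU _ _) _; rewrite leq_add2l.
    by rewrite cardsE; apply: leq_trans (card_size _) _.
  (* Excluded are at most [B] hyperedges of [H0], fewer than [l] of the current star, and at most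
     [2 ^ B] subsets of [S]. *)
  have [e] : exists2 e, e \in [set e in H | c \in e] &
      e \notin H0 :|: [set f in es] :|: powerset S.
    apply/subsetPn; apply: contraTN (cdeg c (mem_head _ _)) => /subset_leq_card.
    rewrite -ltnNge => h; apply: leq_ltn_trans h _.
    apply: leq_ltn_trans (leq_card_setU _ _) _; rewrite card_powerset -addSn.
    apply: leq_add; last by rewrite leq_exp2l.
    apply: leq_ltn_trans (leq_card_setU _ _) _.
    have : #|[set f in es]| <= size es by rewrite cardsE card_size.
    move=> h; rewrite addnC -addSn leq_add ?(leq_trans (leq_addr _ _) bH) //.
    by apply: leq_ltn_trans h _; rewrite sze.
  rewrite !inE !negb_or => /andP[eH ce] /andP[/andP[eH0 ees] /subsetPn[v ve]].
  rewrite !inE !negb_or => /andP[/andP[vW0 vcs] vvs].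
  by exists e, v; rewrite !inE !negb_or eH eH0 vW0 vcs.
have cW0 : c \notin W0 by apply: csW0; apply: mem_head.
have W1cs x : x \in W1 -> x \notin W0 /\ x \notin cs.
  move/(subsetP W1A); rewrite !inE !negb_or => /orP[/eqP->//|/andP[]] //.
have [|||||W2 [Hs2 [star2 W2A Hs2H]]] := IHcs (W0 :|: W1) (H0 :|: Hs1) => //.
- by move=> x xcs; apply: cdeg; rewrite inE xcs orbT.
- move=> x xcs; rewrite inE negb_or csW0 ?inE ?xcs ?orbT //=.
  by apply/negP => /W1cs[_]; rewrite xcs.
- apply: leq_trans (leq_add (leq_card_setU _ _) (leqnn _)) _.
  by apply: leq_trans bW; rewrite mulSn -addnA leq_add2l leq_add2r ltnW.
- apply: leq_trans (leq_add (leq_card_setU _ _) (leqnn _)) _.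
  by apply: leq_trans bH; rewrite mulSn -addnA leq_add2l leq_add2r.
exists (W1 :|: W2), (Hs1 :|: Hs2); split.
- apply: berge_in_copiesS => //; rewrite -setI_eq0; apply/eqP/setP => x; rewrite !inE.
    by apply/negP => /andP[xW1 /(subsetP W2A)]; rewrite !inE xW1 orbT.
  by apply/negP => /andP[xH1 /(subsetP Hs2H)]; rewrite !inE xH1 orbT.
- rewrite subUset; apply/andP; split.
    by apply/subsetP => x /W1cs[]; rewrite inE.
  by apply: subset_trans W2A _; rewrite setCS subsetUl.
- rewrite subUset Hs1H /=; apply: subset_trans Hs2H _.
  by rewrite setDS // subsetUl.
Qed.

Lemma berge_free_card_le k l1 l2 r H : 2 <= k -> 3 <= l1 -> 2 <= l2 ->
  l1 + l2 + k - 1 <= r -> uniform r H ->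
  ~~ contains_berge (dunion (path_graph l1) (copies (k - 1) (star_graph l2))) H ->
  let s := r - k + 2 in
  let B := l1 * r + k * l2.+2 in
  let D := l2 + B + 2 ^ B in
  s * #|H| <= (maxn l1 l2 - 1) * #|V| + s * (D * (l1 * r + k * (l2 * r + l2.+1))).
Proof.
move=> k2 l13 l22 hr /forallP uni free; cbv zeta.
set s := r - k + 2; set B := _ + k * l2.+2; set D := l2 + B + 2 ^ B.
have szr e : e \in H -> #|e| = r by move=> eH; have := uni e; rewrite eH => /eqP.
rewrite leqNgt; apply/negP => big.
have sl : l1 + 3 <= s by rewrite /s; lia.
have l10 : 0 < l1 by lia.
(* Common frame of both cases: [big] and [card_edges_le], applied to the traces [e :\: K], yield a
   Berge path outside [K], so it suffices to complete any such path by disjoint stars. *)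
have no_copy K : (forall e, e \in H -> s <= #|e :\: K|.+1) ->
    (forall e f, e \in H -> f \in H -> e != f -> s <= #|(e :\: K) :|: (f :\: K)|) ->
    (forall W X, berge_in (path_graph l1) W X -> X \subset H -> #|X| = l1 ->
       W \subset (\bigcup_(e in X) e) :\: K -> exists W' X',
       [/\ berge_in (copies (k - 1) (star_graph l2)) W' X', [disjoint W & W'],
         [disjoint X & X'] & X' \subset H]) -> False.
  move=> sz sz2 ext.
  have : s * #|H| <= l1.-1 * #|\bigcup_(e in H) (e :\: K)|.
    apply: card_edges_le => // a b p ep Xl.
    have [_ _ _ XH] := ep.
    have := @berge_in_epath _ (fun e => e :\: K) H l1 a b p l10 _ _ ep Xl.
    set X := edges_of _ in Xl XH *; move=> /= path_in.
    have {}path_in : berge_in (path_graph l1) (\bigcup_(e in X) (e :\: K)) X.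
      by apply: path_in => [e|e /sz]; [apply: subsetDl|lia].
    have [|W' [X' [stars dW dX X'H]]] := ext _ _ path_in XH Xl.
      apply/bigcupsP => e eX; apply: setSD; exact: bigcup_sup.
    move/negP: free; apply; apply: contains_berge_in.
    apply: berge_in_sub (subxx _) _ (berge_in_dunion dW dX path_in stars).
    by rewrite subUset XH.
  have : #|\bigcup_(e in H) (e :\: K)| <= #|V| := max_card _.
  move=> h1 h2; move: big; rewrite ltnNge => /negP[]; apply: leq_trans h2 _.
  apply: leq_trans (leq_addr _ _); apply: leq_mul => //; lia.
have cardX (X : {set {set V}}) : X \subset H -> #|X| = l1 -> #|\bigcup_(e in X) e| <= l1 * r.
  move=> XH Xl; rewrite -Xl; apply: card_bigcup_le => e /(subsetP XH)/szr->; exact: leqnn.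
pose K := [set v | D <= deg H v].
(* With at most [k - 2] vertices of large degree, traces keep [r - (k - 2) = s] vertices, and the
   stars are built away from all hyperedges of the path. *)
have [Kk|Kk] := leqP #|K| (k - 2).
  have sz e : e \in H -> s <= #|e :\: K|.
    move=> eH; have := cardsID K e; rewrite (szr _ eH).
    have := subset_leq_card (subsetIr e K); rewrite /s; lia.
  apply: (no_copy K) => [e /sz|e f eH fH _|W X pW XH Xl WX].
  - lia.
  - by apply: leq_trans (sz _ eH) _; apply/subset_leq_card/subsetUl.
  have [|||||W' [X' [stars W'A X'H X'd]]] :=
      @far_stars H K r s D l2 _ _ _ _ (k - 1) (\bigcup_(e in X) e).
  - by lia.
  - by rewrite /s; lia.
  - by move=> e eH; rewrite sz // szr.
  - by move=> v; rewrite inE -ltnNge => /ltnW.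
  - apply: leq_ltn_trans big; apply: leq_add.
      by rewrite leq_mul2r; apply/orP; right; lia.
    rewrite leq_mul2l leq_mul2l; apply/orP; right; apply/orP; right.
    apply: leq_add; first exact: cardX.
    by rewrite leq_mul2r; apply/orP; right; lia.
  exists W', X'; split=> //.
  - rewrite -setI_eq0; apply/eqP/setP => x; rewrite !inE; apply/negP => /andP[xW].
    move/(subsetP W'A); have := subsetP WX _ xW; rewrite !inE.
    by move=> /andP[_ ->]; rewrite orbT.
  - rewrite -setI_eq0; apply/eqP/setP => e; rewrite !inE; apply/negP => /andP[eX eX'].
    have /set0Pn[v veK] : e :\: K != set0.
      by rewrite -card_gt0; have := sz _ (subsetP XH _ eX); lia.
    have := disjointFr (X'd _ eX') veK; move/negP; apply.
    by apply/bigcupP; exists e => //; move: veK; rewrite inE => /andP[].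
(* Otherwise [k - 1] vertices of large degree serve as centres. Traces may now have only [s.-1]
   vertices, but two distinct hyperedges cover at least [r.+1] vertices, of which [s] survive the
   removal. *)
pose cs := take (k - 1) (enum K).
have szcs : size cs = k - 1 by rewrite size_take -cardE; case: ltnP; lia.
have ucs : uniq cs by rewrite take_uniq // enum_uniq.
have csK c : c \in cs -> D <= deg H c.
  by move/mem_take; rewrite mem_enum inE.
pose K' := [set x in cs].
have cK' : #|K'| = k - 1 by rewrite cardsE (card_uniqP ucs).
have sz (e : {set V}) : #|e| <= #|e :\: K'| + (k - 1).
  have := cardsID K' e; have := subset_leq_card (subsetIr e K'); lia.
apply: (no_copy K') => [e eH|e f eH fH ef|W X pW XH Xl WX].
- by have := sz e; rewrite (szr _ eH) /s; lia.
- rewrite -setDUl; have := sz (e :|: f).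
  have : r < #|e :|: f|.
    rewrite ltnNge; apply/negP => le; case/eqP: ef.
    have Ee : e = e :|: f by apply/eqP; rewrite eqEcard subsetUl (szr e eH).
    have Ef : f = e :|: f by apply/eqP; rewrite eqEcard subsetUr (szr f fH).
    by rewrite Ee -Ef.
  by rewrite /s; lia.
have cW : #|W| <= l1 * r.
  apply: leq_trans (cardX _ XH Xl); apply: subset_leq_card.
  exact: subset_trans WX (subsetDl _ _).
have [||||W' [X' [stars W'A X'H]]] := @centered_stars H l2 B cs W X ucs.
- exact: csK.
- move=> c ccs; apply/negP => /(subsetP WX); by rewrite !inE ccs.
- by rewrite szcs /B leq_add // leq_mul2r; apply/orP; right; lia.
- rewrite szcs Xl /B; apply: leq_add; first by rewrite leq_pmulr //; lia.
  by apply: leq_mul; lia.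
rewrite szcs in stars; exists W', X'; split=> //.
- rewrite -setI_eq0; apply/eqP/setP => x; rewrite !inE; apply/negP => /andP[xW].
  by move/(subsetP W'A); rewrite inE xW.
- rewrite -setI_eq0; apply/eqP/setP => e; rewrite !inE; apply/negP => /andP[eX].
  by move/(subsetP X'H); rewrite inE eX.
- exact: subset_trans X'H (subsetDl _ _).
Qed.

End Upper.

(** * Lower bound *)

Section Lower.
Variables (n t s q : nat).
Hypotheses (s2 : 1 < s) (fit : t + q * s <= n).

(** Truncated subtraction puts core vertices [x < t] into block 0, so the block index is meaningful
    only for [t <= x]. *)
Definition block (x : nat) := (x - t) %/ s.

Definition block_edge (j b : nat) : {set 'I_n} :=
  [set x : 'I_n | (x < t) || (block x == j) && ((x - t) %% s != b)].

Lemma vertex_lt (j : 'I_q) o : o < s -> t + (j * s + o) < n.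
Proof.
by move=> os; have := leq_mul (ltn_ord j) (leqnn s); rewrite mulSn; lia.
Qed.

Definition block_vertex j o (os : o < s) : 'I_n := Ordinal (vertex_lt j os).

Lemma block_vertexE j o (os : o < s) :
  (t <= block_vertex j os) /\ block (block_vertex j os) = j /\
  (block_vertex j os - t) %% s = o.
Proof.
rewrite /block /= leq_addr addKn divnMDl ?modnMDl; last by lia.
by rewrite divn_small // modn_small // addn0.
Qed.

Lemma mem_block_vertex j o (os : o < s) j' b :
  (block_vertex j os \in block_edge j' b) = (j == j' :> nat) && (o != b).
Proof.
have [h1 [h2 h3]] := block_vertexE j os.
by rewrite inE h2 h3 ltnNge h1.
Qed.

Lemma card_block_edge (j : 'I_q) b : b < s -> #|block_edge j b| = t + s.-1.
Proof.
move=> bs.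
pose core := [set x : 'I_n | x < t].
pose blk := [set block_vertex j (ltn_ord o) | o : 'I_s].
have Ec : #|core| = t.
  have tn : t <= n by apply: leq_trans fit; apply: leq_addr.
  have winj : injective (widen_ord tn) by move=> x y /(congr1 val) /= /val_inj.
  rewrite -[RHS]card_ord -(card_imset _ winj).
  apply: eq_card => x; rewrite inE; apply/idP/imsetP => [xt|[y _ ->]]; last exact: (ltn_ord y).
  by exists (Ordinal xt) => //; apply: val_inj.
have Eb : #|blk| = s.
  rewrite card_imset ?card_ord // => o o' E; apply: val_inj => /=.
  have [_ [_ <-]] := block_vertexE j (ltn_ord o).
  by rewrite E; have [_ [_ ->]] := block_vertexE j (ltn_ord o').
have -> : block_edge j b = (core :|: blk) :\ block_vertex j bs.
  apply/setP => x; rewrite !inE.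
  have [hb1 [hb2 hb3]] := block_vertexE j bs.
  have [xt|xt] := ltnP x t.
    by rewrite andbT; apply/esym/eqP => E; move: xt; rewrite E ltnNge hb1.
  rewrite /=; apply/andP/andP => -[].
    move=> /eqP xj xb; split; first by apply: contraNneq xb => ->; rewrite hb3.
    have om : (x - t) %% s < s by rewrite ltn_mod; lia.
    apply/imsetP; exists (Ordinal om) => //; apply: val_inj => /=.
    by rewrite -xj -divn_eq subnKC.
  move=> xv /imsetP[o _ E]; have [_ [h2 h3]] := block_vertexE j (ltn_ord o).
  rewrite E h2 h3 eqxx; split=> //; apply: contraNneq xv => ob.
  by rewrite E; apply/eqP; apply: val_inj; rewrite /= ob.
have := cardsD1 (block_vertex j bs) (core :|: blk).
have -> : block_vertex j bs \in core :|: blk.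
  rewrite inE; apply/orP; right; apply/imsetP; exists (Ordinal bs) => //.
  exact: val_inj.
rewrite cardsU Ec Eb.
have -> : core :&: blk = set0.
  apply/setP => x; rewrite !inE; apply/negP => /andP[xt /imsetP[o _ E]].
  by have [h1 _] := block_vertexE j (ltn_ord o); move: xt; rewrite E ltnNge h1.
by rewrite cards0 subn0 add1n => E; apply: succn_inj; rewrite -E; lia.
Qed.

Variable m : nat.

Definition block_hypergraph : {set {set 'I_n}} :=
  [set block_edge p.1 p.2 | p : 'I_q * 'I_m].

(** A vertex of the block other than the omitted one recovers [j], and it exists because [s > 1];
    the omitted vertex then recovers [b]. *)
Lemma card_block_hypergraph : m <= s -> #|block_hypergraph| = m * q.
Proof.
move=> ms; rewrite card_imset ?card_prod ?card_ord 1?mulnC // => -[j b] [j' b'] /= E.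
have [o os ob] : exists2 o, o < s & o != b.
  by case: (nat_of_ord b) => [|b0]; [exists 1|exists 0 => //; lia].
have := mem_block_vertex j os j b; rewrite E mem_block_vertex eqxx ob /=.
move=> /andP[/eqP/val_inj jj _]; subst j'.
have bs : b < s by apply: leq_trans ms.
have := mem_block_vertex j bs j b; rewrite E mem_block_vertex !eqxx /=.
by move=> /negbFE/eqP/val_inj->.
Qed.

Lemma set2_ord_inj (G : finType) (g : nat -> G) l i j : i < l -> j < l ->
  (forall a b, a <= l -> b <= l -> g a = g b -> a = b) ->
  [set g i; g i.+1] = [set g j; g j.+1] -> i = j.
Proof.
move=> il jl ginj /set2_inj[].
- by apply/negP => /eqP/ginj; lia.
- by case=> /ginj h _; apply: h; lia.
- by case=> /ginj h1 /ginj h2; lia.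
Qed.

(** The graph has [t.+1] components and the core only [t] vertices, so one component is embedded off
    the core. A path there stays in one block, and so do the hyperedges at the centre of a star, but
    a block carries only [m] hyperedges while the component has more than [m] edges. *)
Lemma block_hypergraph_free l1 l2 : m < l1 -> m < l2 ->
  ~~ contains_berge (dunion (path_graph l1) (copies t (star_graph l2)))
    block_hypergraph.
Proof.
move=> ml1 ml2; set F := dunion _ _.
apply/negP => /existsP[H' /andP[H'H /existsP[f /existsP[phi]]]].
move=> /and4P[/injectiveP finj /dinjectiveP phi_inj /eqP EH /forallP sub].
have phiP x y : @adj F x y ->
    [/\ [set x; y] \in edges F, phi [set x; y] \in block_hypergraph,
        f x \in phi [set x; y] & f y \in phi [set x; y]].
  move=> xy; have xyE : [set x; y] \in edges F.
    by apply/imsetP; exists (x, y) => //; rewrite inE.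
  split=> //.
  - by apply: (subsetP H'H); rewrite -EH imset_f.
  - by have := sub [set x; y]; rewrite xyE => /subsetP; apply; rewrite imset_f // !inE eqxx.
  - by have := sub [set x; y]; rewrite xyE => /subsetP; apply; rewrite imset_f // !inE eqxx orbT.
have phi_block x y : @adj F x y -> t <= f x -> exists b : 'I_m,
    phi [set x; y] = block_edge (block (f x)) b.
  move=> xy tx; have [_ /imsetP[[j b] _ /= E] fx _] := phiP _ _ xy.
  exists b; move: fx; rewrite E inE ltnNge tx /= => /andP[/eqP-> _].
  by [].
have same_block x y : @adj F x y -> t <= f x -> t <= f y -> block (f y) = block (f x).
  move=> xy tx ty; have [_ _ _ fy] := phiP _ _ xy; have [b E] := phi_block _ _ xy tx.
  by move: fy; rewrite E inE ltnNge ty /= => /andP[/eqP].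
(* Only the ends [u i] need to lie in block [j] off the core, so for a star the centre alone
   suffices. *)
have few_edges (u v : 'I_m.+1 -> F) j : (forall i, @adj F (u i) (v i)) ->
    (forall i, t <= f (u i)) -> (forall i, block (f (u i)) = j) ->
    (forall i i', [set u i; v i] = [set u i'; v i'] -> i = i') -> False.
  move=> uv tu bu inj.
  have : #|[set phi [set u i; v i] | i : 'I_m.+1]| <= #|[set block_edge j b | b : 'I_m]|.
    apply/subset_leq_card/subsetP => e /imsetP[i _ ->].
    by have [b ->] := phi_block _ _ (uv i) (tu i); rewrite bu imset_f.
  rewrite card_imset; last first.
    move=> i i' E; apply: inj; apply: phi_inj E.
      by have [] := phiP _ _ (uv i).
    by have [] := phiP _ _ (uv i').
  move=> le; have := leq_trans le (leq_imset_card _ _).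
  by rewrite !card_ord ltnn.
(* Components are labelled by [option 'I_t], with [None] for the path. *)
pose comp (x : F) : option 'I_t := match x with inl _ => None | inr y => Some y.1 end.
have [c cP] : exists c, forall x, comp x = c -> t <= f x.
  pose C := [set x : F | f x < t].
  have cC : #|C| <= t.
    rewrite -(card_imset _ finj) -[X in _ <= X]card_ord.
    have gP (y : 'I_n) : y \in f @: C -> y < t by move=> /imsetP[x]; rewrite inE => ? ->.
    (* An empty core is treated apart, because [insubd] below needs a default element of ['I_t]. *)
    case: (posnP t) => [t0|t0].
      rewrite [X in X <= _](_ : _ = 0) //; apply/eqP; rewrite cards_eq0.
      by apply/eqP/setP => y; rewrite [RHS]inE; apply/negP => /gP; lia.
    have ginj : {in f @: C &, injective (fun y : 'I_n => insubd (Ordinal t0) (y : nat))}.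
      move=> y z /gP yt /gP zt /(congr1 val); rewrite !val_insubd yt zt.
      exact: val_inj.
    by rewrite -(card_in_imset ginj) max_card.
  have : #|comp @: C| < #|{: option 'I_t}|.
    rewrite card_option card_ord ltnS; exact: leq_trans (leq_imset_card _ _) cC.
  rewrite -cardsT => lt.
  have [c _ cC'] : exists2 c, c \in [set: option 'I_t] & c \notin comp @: C.
    by apply/subsetPn; apply: contraTN lt => /subset_leq_card; rewrite -leqNgt.
  exists c => x xc; rewrite leqNgt; apply: contra cC' => fx.
  by apply/imsetP; exists x; rewrite ?inE.
case: c cP => [c|] cP.
  pose u (i : 'I_m.+1) : F := inr (c, ord0).
  pose v (i : 'I_m.+1) : F := inr (c, inord i.+1).
  apply: (few_edges u v (block (f (u ord0)))) => //.
  - move=> i; rewrite /= /copies_adj /= eqxx /= /star_adj eqxx.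
    by rewrite -val_eqE /= inordK //; have := ltn_ord i; lia.
  - by move=> i; apply: cP.
  - move=> i i' /set2_inj[].
    + by rewrite /u /v; apply/eqP => -[] /(congr1 val) /=; rewrite inordK //; have := ltn_ord i; lia.
    + move=> [_ [/(congr1 val)]]; rewrite /= !inordK; [|have := ltn_ord i'; lia|have := ltn_ord i; lia].
      by move=> [/val_inj].
    + move=> [[/(congr1 val)]]; rewrite /= inordK //; have := ltn_ord i'; lia.
pose g i : F := inl (inord i : 'I_l1.+1).
have gadj i : i < l1 -> @adj F (g i) (g i.+1).
  by move=> il; rewrite /= /path_adj !inordK ?eqxx //; lia.
have gblock i : i <= l1 -> block (f (g i)) = block (f (g 0)).
  elim: i => // i IHi il; rewrite -IHi; last by lia.
  by apply: same_block; [apply: gadj|apply: cP|apply: cP].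
apply: (few_edges (fun i => g i) (fun i => g i.+1) (block (f (g 0)))).
- by move=> i; apply: gadj; have := ltn_ord i; lia.
- by move=> i; apply: cP.
- by move=> i; apply: gblock; have := ltn_ord i; lia.
- move=> i i' E; apply: val_inj; apply: (@set2_ord_inj _ g l1) E.
  + by have := ltn_ord i; lia.
  + by have := ltn_ord i'; lia.
  + by move=> a b al bl [] /(congr1 val); rewrite /= !inordK.
Qed.

End Lower.

(** * Assembling the two bounds *)

Theorem theorem2p4 (k l1 l2 r : nat) (hk : 2 <= k) (hl1 : 3 <= l1)
    (hl2 : 2 <= l2) (hr : l1 + l2 + k - 1 <= r) :
  exists C : rat, exists N : nat, forall n : nat, N <= n ->
    let ex := ex_berge r n
      (dunion (path_graph l1) (copies (k - 1) (star_graph l2))) in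
    (minn l1 l2 - 1) * ((n - k + 1) %/ (r - k + 2)) <= ex /\
    (ex%:R <= ((maxn l1 l2 - 1) * n)%:R / (r - k + 2)%:R + C :> rat)%R.
Proof.
set B := l1 * r + k * l2.+2; set D := l2 + B + 2 ^ B.
set C := D * (l1 * r + k * (l2 * r + l2.+1)).
(* The threshold [k] makes the truncated [n - k + 1] exact, so that the core of [k - 1] vertices and
   the [q] blocks fit into [n] vertices. *)
exists C%:R%R, k => n kn; cbv zeta; set s := r - k + 2; set F := dunion _ _.
set m := minn l1 l2 - 1; set q := _ %/ s.
split.
  have s2 : 1 < s by rewrite /s; lia.
  have ms : m <= s by rewrite /s /m; lia.
  have fit : (k - 1) + q * s <= n.
    by have := leq_trunc_div (n - k + 1) s; rewrite -/q; lia.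
  rewrite -(card_block_hypergraph s2 fit ms).
  apply: (@leq_bigmax_cond _ _ (fun H : {set {set 'I_n}} => #|H|)).
  apply/andP; split; last by apply: block_hypergraph_free; rewrite /m; lia.
  apply/forallP => e; apply/implyP => /imsetP[[j b] _ ->] /=.
  by rewrite (card_block_edge s2 fit) ?(leq_trans (ltn_ord b)) // /s; lia.
have s0 : 0 < s by rewrite /s; lia.
(* The upper bound is proved over the naturals after multiplication by [s]; the additive term
   [s * C] becomes the constant [C] on division. *)
have : s * ex_berge r n F <= (maxn l1 l2 - 1) * n + s * C.
  apply: (@big_ind _ (fun x => s * x <= _)) => [|x y hx hy|H /andP[uni free]].
  - by rewrite muln0.
  - by rewrite maxnMr geq_max hx.
  - by have := berge_free_card_le hk hl1 hl2 hr uni free; rewrite card_ord.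
move: (ex_berge _ _ _) => ex le.
have s0' : (0 < s%:R :> rat)%R by rewrite ltr0n.
rewrite -(ler_pM2r s0') mulrDl divfK ?gt_eqF // -!natrM -natrD ler_nat.
by rewrite mulnC (mulnC C).
Qed.
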